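(* Let $(b,c)$ be a graph over a discrete measure space $(X,m)$ and suppose that $\inf_{x\in X}m(x)>0$. Then for every $p\in[1,\infty]$, $$\sigma(L_2)\subseteq\sigma(L_p).$$
   Context: Graphs. $X$ is a countable set with the discrete topology, $m:X\to(0,\infty)$, and $m(A)=\sum_{x\in A}m(x)$ for $A\subseteq X$. A graph over $(X,m)$ is a pair $(b,c)$ with $c:X\to[0,\infty)$ and $b:X\times X\to[0,\infty)$ symmetric, with zero diagonal, and $\sum_{y\in X}b(x,y)<\infty$ for all $x\in X$. It is assumed that for every $x\in X$ there is $y\in X$ with $b(x,y)>0$. The graph is not assumed to be locally finite. Operators. $\ell^p=\ell^p(X,m)$, $p\in[1,\infty]$, are the complex $\ell^p$-spaces with norms $\|f\|_p=(\sum_x|f(x)|^pm(x))^{1/p}$ for $p<\infty$ and $\|f\|_\infty=\sup_x|f(x)|$. $C_c(X)$ is the space of finitely supported complex functions. Let $$Q(f,g)=\frac12\sum_{x,y\in X}b(x,y)(f(x)-f(y))\overline{(g(x)-g(y))}+\sum_{x\in X}c(x)f(x)\overline{g(x)},$$ with domain $D(Q)$ the closure of $C_c(X)$ with respect to $\|f\|_Q=(Q(f,f)+\|f\|_2^2)^{1/2}$. This is a regular Dirichlet form on $\ell^2(X,m)$; $L=L_2$ is the associated positive selfadjoint operator, which acts as $Lf(x)=\frac1{m(x)}\sum_{y}b(x,y)(f(x)-f(y))+\frac{c(x)}{m(x)}f(x)$. The semigroup $T_t=e^{-tL}$, $t\ge0$, extends consistently to contraction semigroups on all $\ell^p$, $p\in[1,\infty]$,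 strongly continuous for $p<\infty$. For $p\in[1,\infty)$, $L_p$ denotes the generator on $\ell^p$ with the sign convention $T_t=e^{-tL_p}$, and $L_\infty:=L_1^*$ is the dual operator of $L_1$ on $\ell^\infty$. $\sigma(L_p)$ denotes the spectrum of $L_p$ on $\ell^p$. *)

(* Defs.v *)
From HB Require Import structures.
From mathcomp Require Import all_boot all_order all_algebra.
From mathcomp Require Import all_classical all_reals all_analysis.
From mathcomp Require Export complex.
Set Implicit Arguments.
Unset Strict Implicit.
Unset Printing Implicit Defensive.
Import Order.TTheory GRing.Theory Num.Theory.
Import numFieldNormedType.Exports.
Local Open Scope classical_set_scope.
Local Open Scope ring_scope.
Local Open Scope complex_scope.

(* The real-valued modulus; `|z| itself has type R[i]. *)
Definition cmod (R : realType) (z : R[i]) : R := ComplexField.Normc.normc z.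

(* Sum of an absolutely summable family of complex numbers, from the
   unconditional sums in [0, +oo] of the positive and negative parts of its
   real and imaginary parts; junk values on families that are not absolutely
   summable. *)
Definition rsum (R : realType) (I : choiceType) (u : I -> R) : R :=
  fine (\esum_(i in [set: I]) (Num.max (u i) 0)%:E) -
  fine (\esum_(i in [set: I]) (Num.max (- u i) 0)%:E).

Definition csum (R : realType) (I : choiceType) (u : I -> R[i]) : R[i] :=
  rsum (fun i => complex.Re (u i)) +i* rsum (fun i => complex.Im (u i)).

Section GraphOperators.
Context {R : realType} {X : countType}.
Implicit Types (m c : X -> R) (b : X -> X -> R) (f g h : X -> R[i]).
Implicit Types (p : \bar R) (z : R[i]).

Record is_graph b c : Prop := IsGraph {
  graph_b_ge0 : forall x y, 0 <= b x y ;
  graph_b_sym : forall x y, b x y = b y x ;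
  graph_b_diag : forall x, b x x = 0 ;
  graph_b_summable : forall x, (\esum_(y in [set: X]) (b x y)%:E < +oo)%E ;
  graph_c_ge0 : forall x, 0 <= c x ;
  graph_no_isolated : forall x, exists y, 0 < b x y
}.

(* Only used for 1 <= p; the value at -oo is junk. *)
Definition lpnorm m p f : \bar R :=
  match p with
  | r%:E => poweR (\esum_(x in [set: X]) (cmod (f x) `^ r * m x)%:E) r^-1
  | +oo%E => ereal_sup (range (fun x => (cmod (f x))%:E))
  | -oo%E => 0%E
  end.

Definition lp m p : set (X -> R[i]) := [set f | (lpnorm m p f < +oo)%E].

Definition Cc : set (X -> R[i]) := [set f | finite_set [set x | f x != 0]].

Definition Qform b c f g : R[i] :=
  2^-1 * csum (fun xy : X * X => (b xy.1 xy.2)%:C *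
           ((f xy.1 - f xy.2) * (g xy.1 - g xy.2)^*)) +
  csum (fun x => (c x)%:C * (f x * (g x)^*)).

(* Q(f, f) as an element of [0, +oo], for arbitrary f. *)
Definition energy b c f : \bar R :=
  ((2^-1)%:E * (\esum_(xy in [set: X * X])
                  (b xy.1 xy.2 * cmod (f xy.1 - f xy.2) ^+ 2)%:E) +
   \esum_(x in [set: X]) (c x * cmod (f x) ^+ 2)%:E)%E.

Definition Qnorm m b c f : \bar R :=
  poweR (energy b c f + poweR (lpnorm m 2%:E f) 2)%E 2^-1.

(* Closure of C_c(X) with respect to Qnorm, inside the space of functions of
   finite Qnorm. *)
Definition form_domain m b c : set (X -> R[i]) :=
  [set f | (Qnorm m b c f < +oo)%E /\
    forall e : R, 0 < e ->
      exists2 phi, Cc phi & (Qnorm m b c (f - phi)%R < e%:E)%E].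

(* Unbounded operators are represented by their graphs: A f g means that f
   belongs to the domain of A and A f = g. *)

(* The operator L = L_2 associated with the form Q. *)
Definition form_operator m b c f g : Prop :=
  [/\ form_domain m b c f, lp m 2%:E g &
    forall h, form_domain m b c h ->
      Qform b c f h = csum (fun x => g x * (h x)^* * (m x)%:C)].

Record lp_contraction_semigroup m p (T : R -> (X -> R[i]) -> (X -> R[i])) :
    Prop := LpContractionSemigroup {
  semigroup_lp : forall t f, 0 <= t -> lp m p f -> lp m p (T t f) ;
  semigroup_linear : forall t z f g, 0 <= t -> lp m p f -> lp m p g ->
    T t (fun x => z * f x + g x) = (fun x => z * T t f x + T t g x) ;
  semigroup_contraction : forall t f, 0 <= t -> lp m p f ->
    (lpnorm m p (T t f) <= lpnorm m p f)%E ;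
  semigroup0 : forall f, lp m p f -> T 0 f = f ;
  semigroupD : forall s t f, 0 <= s -> 0 <= t -> lp m p f ->
    T (s + t) f = T s (T t f)
}.

Definition strongly_continuous m p (T : R -> (X -> R[i]) -> (X -> R[i])) :
    Prop :=
  forall f, lp m p f -> lpnorm m p (T t f - f) @[t --> 0^'+] --> 0%E.

(* With the sign convention T_t = exp (- t A). *)
Definition generator m p (T : R -> (X -> R[i]) -> (X -> R[i])) f g : Prop :=
  [/\ lp m p f, lp m p g &
    lpnorm m p (fun x => (t^-1)%:C * (f x - T t f x) - g x)
      @[t --> 0^'+] --> 0%E].

(* T_t = exp (- t L) together with its consistent extensions to all the l^p
   spaces. That the extensions are consistent is expressed by having a single
   map T_t acting on the functions of every l^p. *)
Record heat_semigroup m b c (T : R -> (X -> R[i]) -> (X -> R[i])) : Prop :=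
  HeatSemigroup {
  heat_contraction : forall p, (1 <= p)%E -> lp_contraction_semigroup m p T ;
  heat_continuous : forall p, (1 <= p)%E -> (p < +oo)%E ->
    strongly_continuous m p T ;
  heat_generator : forall f g,
    generator m 2%:E T f g <-> form_operator m b c f g
}.

(* The dual on l^oo = (l^1)' of an operator A on l^1. *)
Definition dual_operator m (A : (X -> R[i]) -> (X -> R[i]) -> Prop) f g :
    Prop :=
  [/\ lp m +oo%E f, lp m +oo%E g &
    forall u v, A u v ->
      csum (fun x => v x * f x * (m x)%:C) =
      csum (fun x => u x * g x * (m x)%:C)].

Definition Lp m (T : R -> (X -> R[i]) -> (X -> R[i])) p :
    (X -> R[i]) -> (X -> R[i]) -> Prop :=
  if p == +oo%E then dual_operator m (generator m 1%:E T)
  else generator m p T.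

(* A - z is a bijection from the domain of A onto l^p, with bounded inverse. *)
Definition resolvent_set m p (A : (X -> R[i]) -> (X -> R[i]) -> Prop) :
    set R[i] :=
  [set z | exists K : R, forall g, lp m p g ->
    exists f, [/\ A f (fun x => g x + z * f x),
      (lpnorm m p f <= K%:E * lpnorm m p g)%E &
      forall f', A f' (fun x => g x + z * f' x) -> f' = f]].

Definition spectrum m p (A : (X -> R[i]) -> (X -> R[i]) -> Prop) :
    set R[i] := ~` resolvent_set m p A.

End GraphOperators.

(* Main.v *)
(** Since [inf m > 0], the spaces l^p increase with p and point masses lie in
    the domain of L = L_2; hence the semigroup is symmetric on l^2 and L is
    selfadjoint, in the sense that [<w, L u> = <k, u>] for all u in the domain
    implies [L w = k].

    Let z be in the resolvent set of L_p.  If p <= 2, then L_p is a restriction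
    of L, so (L - z) w = v is solvable for v in l^p with an l^p bound.  If
    p > 2, then L is a restriction of L_p and the transpose of the resolvent of
    L_p solves the same equation in l^q, 1/p + 1/q = 1, with an l^q bound.

    So let q <= 2 and let (L - z) w = v be solvable in l^q with constant K.
    For z nonreal, the imaginary part of <(L - z) u, u> bounds L - z from below
    on l^2.  For z real, iterating v_n = (L - z) v_(n+1) yields a sequence with
    |v_n|^2 <= |v_(n-1)| |v_(n+1)| in l^2, by symmetry, which is also
    O(K^n) because l^q embeds in l^2; log-convexity then forces
    |v_1| <= K |v_0| (Krein, Lax).  In both cases transposing once more, now on
    l^2, gives the resolvent of L. *)
Require Import Defs.
From mathcomp Require Import all_boot all_order all_algebra.
From mathcomp Require Import finmap.
From mathcomp Require Import all_classical all_reals all_analysis.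
From mathcomp Require Import ring lra.
Import Order.TTheory GRing.Theory Num.Theory.
Import numFieldNormedType.Exports.
Set Implicit Arguments.
Unset Strict Implicit.
Unset Printing Implicit Defensive.
Local Open Scope classical_set_scope.
Local Open Scope ring_scope.
Local Open Scope complex_scope.

(** * Unconditional sums of complex families *)

(** Selfadjointness of L is derived from the data in [heat_semigroup] alone. Symmetry of the form
    makes the generator symmetric; cutting [0, t] into n short steps makes each T_s equal to 1 - s L
    up to an error o(s), and adding n such errors gives symmetry of T_t without integrating in time.
    The same discretisation turns weak solutions of L w = k into strong ones. A point mass lies in
    the domain of L without local finiteness because its formal Laplacian is in l^1, hence in l^2.
    Interpolating between l^p and l^q would require the resolvents on the two spaces to agree on
    common functions. The Krein-Lax iteration avoids this: it needs a solution operator only on the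
    smaller space l^q, together with the symmetry of L. Duality is expressed by a bilinear pairing,
    so that transposition keeps z itself; conjugation, which commutes with L, enters where squared
    norms are needed. *)

Section Modulus.
Context {R : realType}.
Implicit Types z w : R[i].

Lemma cmod_ge0 z : 0 <= cmod z.
Proof. by case: z => x y; rewrite /cmod /= sqrtr_ge0. Qed.

Lemma cmodM z w : cmod (z * w) = cmod z * cmod w.
Proof. exact: ComplexField.Normc.normcM. Qed.

Lemma cmod0 : cmod (0 : R[i]) = 0.
Proof. exact: ComplexField.Normc.normc0. Qed.

Lemma cmod_eq0 z : (cmod z == 0) = (z == 0).
Proof.
apply/eqP/eqP => [|->]; last exact: cmod0.
exact: ComplexField.Normc.eq0_normc.
Qed.

Lemma normE_cmod z : `|z| = (cmod z)%:C.
Proof. by case: z. Qed.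

Lemma le_cmodD z w : cmod (z + w) <= cmod z + cmod w.
Proof. by have := ler_normD z w; rewrite !normE_cmod -rmorphD /= lecR. Qed.

Lemma cmodN z : cmod (- z) = cmod z.
Proof. by apply: complexI; rewrite -!normE_cmod normrN. Qed.

Lemma le_cmodB z w : cmod (z - w) <= cmod z + cmod w.
Proof. by rewrite (le_trans (le_cmodD _ _))// cmodN. Qed.

Lemma cmod_conj z : cmod z^* = cmod z.
Proof. by apply: complexI; rewrite -!normE_cmod normcJ. Qed.

Lemma cmod_real (x : R) : cmod x%:C = `|x|.
Proof. by rewrite /cmod /= expr0n addr0 sqrtr_sqr. Qed.

(* The notation [z^*] stands for [Num.conj z] inside ring operations and for
   the convertible [conjc z] elsewhere. *)
Lemma conjCE z : Num.conj z = conjc z.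
Proof. by []. Qed.

Lemma conjcD z w : conjc (z + w) = conjc z + conjc w.
Proof. exact: rmorphD. Qed.

Lemma conjcB z w : conjc (z - w) = conjc z - conjc w.
Proof. exact: rmorphB. Qed.

Lemma conjcM z w : conjc (z * w) = conjc z * conjc w.
Proof. exact: rmorphM. Qed.

Lemma mulc_conj z : z * z^* = (cmod z ^+ 2)%:C.
Proof. by rewrite -sqr_normc normE_cmod rmorphXn. Qed.

Lemma cmod_Re z : `|complex.Re z| <= cmod z.
Proof. by have := normc_ge_Re z; rewrite normE_cmod lecR. Qed.

Lemma cmod_Im z : `|complex.Im z| <= cmod z.
Proof.
case: z => x y; rewrite /cmod /= -sqrtr_sqr ler_wsqrtr//.
by rewrite lerDr sqr_ge0.
Qed.

Lemma le_cmod_sum (I : Type) (r : seq I) (P : pred I) (u : I -> R[i]) :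
  cmod (\sum_(i <- r | P i) u i) <= \sum_(i <- r | P i) cmod (u i).
Proof.
elim/big_ind2 : _ => //; first by rewrite cmod0.
by move=> x a y b ax by_; rewrite (le_trans (le_cmodD _ _))// lerD.
Qed.

End Modulus.

Section UnconditionalSums.
Context {R : realType} {I : choiceType}.
Implicit Types (u v : I -> R[i]) (s t : R[i]) (A B : {fset I}) (C : R).

(** Convergence along the directed set of finite subsets. Identities are proved for [has_sum] and
    carried to [csum] by uniqueness, under a bound on the absolute sums that rules out the junk
    values of [csum]. *)
Definition has_sum u s := forall e : R, 0 < e -> exists A, forall B,
  (A `<=` B)%fset -> cmod (s - \sum_(i <- B) u i) <= e.

Definition sum_bounded u C := forall A, \sum_(i <- A) cmod (u i) <= C.

Lemma has_sum_le u s C : has_sum u s -> sum_bounded u C -> cmod s <= C.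
Proof.
move=> us uC; apply/ler_addgt0Pr => e /us[A /(_ _ (fsubset_refl A)) sA].
rewrite -[s](subrK (\sum_(i <- A) u i)) (le_trans (le_cmodD _ _))//.
by rewrite addrC lerD// (le_trans (le_cmod_sum _ _ _)).
Qed.

Lemma has_sum_unique u s t : has_sum u s -> has_sum u t -> s = t.
Proof.
move=> us ut; apply/eqP; rewrite -subr_eq0 -cmod_eq0 eq_le cmod_ge0 andbT.
apply/ler_addgt0Pr => e e0; rewrite add0r.
have [A sA] := us _ (divr_gt0 e0 (ltr0n R 2)).
have [B tB] := ut _ (divr_gt0 e0 (ltr0n R 2)).
have {}sA := sA _ (fsubsetUl A B); have {}tB := tB _ (fsubsetUr A B).
rewrite (_ : s - t = (s - \sum_(i <- (A `|` B)%fset) u i) -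
  (t - \sum_(i <- (A `|` B)%fset) u i)); last by ring.
by rewrite (le_trans (le_cmodB _ _))// [leRHS]splitr lerD.
Qed.

Lemma has_sum_linear (a : R[i]) u v s t : has_sum u s -> has_sum v t ->
  has_sum (fun i => a * u i + v i) (a * s + t).
Proof.
move=> us vt e e0.
have a0 : 0 < cmod a + 1 by rewrite ltr_wpDl// cmod_ge0.
have [A sA] := us _ (divr_gt0 (divr_gt0 e0 (ltr0n R 2)) a0).
have [B tB] := vt _ (divr_gt0 e0 (ltr0n R 2)).
exists (A `|` B)%fset => D; rewrite fsubUset => /andP[/sA sD /tB tD].
rewrite big_split/= -mulr_sumr.
rewrite (_ : _ - _ = a * (s - \sum_(i <- D) u i) + (t - \sum_(i <- D) v i));
  last by ring.
rewrite (le_trans (le_cmodD _ _))// [leRHS]splitr lerD// cmodM.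
rewrite (le_trans (ler_wpM2l (cmod_ge0 a) sD))//.
rewrite mulrCA ler_piMr ?divr_ge0// ?(ltW e0)//.
by rewrite ler_pdivrMr// mul1r lerDl.
Qed.

Lemma has_sum_fset A u : (forall i, i \notin A -> u i = 0) ->
  has_sum u (\sum_(i <- A) u i).
Proof.
move=> uA e e0; exists A => B AB.
rewrite (big_fset_incl _ AB)//=; last by move=> i _ /uA.
by rewrite subrr cmod0 ltW.
Qed.

Lemma le_sum_fset (w : I -> R) A B : (forall i, 0 <= w i) ->
  (A `<=` B)%fset -> \sum_(i <- A) w i <= \sum_(i <- B) w i.
Proof.
move=> w0 AB; rewrite (big_fsetID _ (mem A) B)/=.
rewrite (_ : [fset x in B | x \in A]%fset = A) ?lerDl ?sumr_ge0//.
apply/fsetP => i; rewrite !inE andb_idl//; exact: (fsubsetP AB).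
Qed.

Lemma has_sum_nonneg (w : I -> R) (C : R) : (forall i, 0 <= w i) ->
  (forall A, \sum_(i <- A) w i <= C) ->
  has_sum (fun i => (w i)%:C) (fine (\esum_(i in [set: I]) (w i)%:E))%:C.
Proof.
move=> w0 wC.
set S := \esum_(i in _) _.
have fsetE A : (\sum_(i \in [set` A]) (w i)%:E = (\sum_(i <- A) w i)%:E)%E.
  by rewrite fsbig_finite//= set_fsetK sumEFin.
have leS A : ((\sum_(i <- A) w i)%:E <= S)%E.
  rewrite -fsetE; apply: ereal_sup_ubound; exists [set` A] => //.
have SC : (S <= C%:E)%E.
  apply: ge_ereal_sup => _ [A [finA _] <-].
  by rewrite fsbig_finite//= sumEFin lee_fin.
have S0 : (0 <= S)%E by apply: esum_ge0 => i _; rewrite lee_fin.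
have Sfin : S \is a fin_num by rewrite ge0_fin_numE// (le_lt_trans SC)// ltry.
move=> e e0.
have [_ [A [finA _] <-] SA] := ub_ereal_sup_adherent e0 Sfin.
have {}SA : fine S - e < \sum_(i <- fset_set A) w i.
  by rewrite -lte_fin EFinB fineK// -sumEFin -fsbig_finite.
exists (fset_set A) => B AB.
rewrite -rmorph_sum -rmorphB cmod_real.
have := leS B; rewrite -(fineK Sfin) lee_fin => leSB.
rewrite ger0_norm ?subr_ge0// lerBlDr -lerBlDl (le_trans (ltW SA))//.
exact: le_sum_fset.
Qed.

Lemma has_sum_ge (w : I -> R) (s : R) B :
  (forall i, 0 <= w i) -> has_sum (fun i => (w i)%:C) s%:C -> \sum_(i <- B) w i <= s.
Proof.
move=> w0 ws; apply/ler_addgt0Pr => e /ws[D /(_ (B `|` D)%fset (fsubsetUr _ _))].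
rewrite -rmorph_sum -rmorphB cmod_real ler_norml => /andP[+ _].
rewrite lerBrDr => le1; have le2 := le_sum_fset w0 (fsubsetUl B D).
lra.
Qed.

Lemma rsum_has_sum (w : I -> R) (C : R) : (forall A, \sum_(i <- A) `|w i| <= C) ->
  has_sum (fun i => (w i)%:C) (rsum w)%:C.
Proof.
move=> wC; rewrite /rsum rmorphB /=.
have pos (h : I -> R) : (forall i, h i <= `|w i|) ->
    has_sum (fun i => (Num.max (h i) 0)%:C)
      (fine (\esum_(i in [set: I]) (Num.max (h i) 0)%:E))%:C.
  move=> hw; apply: (@has_sum_nonneg _ C) => [i|A]; first by rewrite le_max lexx orbT.
  by rewrite (le_trans _ (wC A))// ler_sum// => i _; rewrite ge_max hw normr_ge0.
have h1 := pos w (fun i => ler_norm _).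
have h2 : has_sum _ _ := pos (fun i => - w i) (fun i => _).
have := has_sum_linear (-1) (h2 _) h1.
rewrite mulN1r addrC; under eq_fun do rewrite mulN1r -rmorphN -rmorphD /=.
rewrite (_ : (fun i => _) = (fun i => (w i)%:C)) => [|].
  by apply => i; rewrite -normrN ler_norm.
apply/funext => i; congr (_%:C); rewrite /Num.max.
by case: (ltP (w i) 0) => ?; case: (ltP (- w i) 0) => ?; lra.
Qed.

Lemma csum_has_sum u (C : R) : sum_bounded u C -> has_sum u (csum u).
Proof.
move=> uC; rewrite (_ : csum u = 'i * (rsum (fun i => complex.Im (u i)))%:C +
   (rsum (fun i => complex.Re (u i)))%:C); last first.
  by apply/eqP; rewrite eq_complex /=; apply/andP; split; apply/eqP; ring.
have uE : u = fun i => 'i * (complex.Im (u i))%:C + (complex.Re (u i))%:C.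
  by apply/funext => i; rewrite addrC -complexE.
rewrite [X in has_sum X _]uE.
by apply: has_sum_linear; apply: (@rsum_has_sum _ C) => A;
  rewrite (le_trans _ (uC A))// ler_sum// => i _; rewrite ?cmod_Im ?cmod_Re.
Qed.

Lemma csum_eq u s (C : R) : sum_bounded u C -> has_sum u s -> csum u = s.
Proof. by move=> /csum_has_sum; apply: has_sum_unique. Qed.

Lemma csum_le u C : sum_bounded u C -> cmod (csum u) <= C.
Proof. by move=> uC; apply: has_sum_le (csum_has_sum uC) uC. Qed.

Lemma sum_bounded_linear (a : R[i]) u v C D : sum_bounded u C ->
  sum_bounded v D -> sum_bounded (fun i => a * u i + v i) (cmod a * C + D).
Proof.
move=> uC vD A; have := lerD (ler_wpM2l (cmod_ge0 a) (uC A)) (vD A).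
apply: le_trans; rewrite mulr_sumr -big_split ler_sum// => i _.
by rewrite -cmodM le_cmodD.
Qed.

Lemma csum_linear (a : R[i]) u v C D : sum_bounded u C -> sum_bounded v D ->
  csum (fun i => a * u i + v i) = a * csum u + csum v.
Proof.
move=> uC vD; apply: csum_eq (sum_bounded_linear a uC vD) _.
by apply: has_sum_linear; apply: csum_has_sum; [exact: uC|exact: vD].
Qed.

Lemma csumZ (a : R[i]) u C : sum_bounded u C ->
  csum (fun i => a * u i) = a * csum u.
Proof.
move=> uC; have := csum_linear (a - 1) uC uC.
rewrite (_ : (fun i => (a - 1) * u i + u i) = fun i => a * u i).
  by move=> ->; ring.
by apply/funext => i; ring.
Qed.

Lemma csumB u v C D : sum_bounded u C ->
  sum_bounded v D -> csum (fun i => u i - v i) = csum u - csum v.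
Proof.
move=> uC vD; have := csum_linear (-1) vD uC.
rewrite (_ : (fun i => -1 * v i + u i) = fun i => u i - v i).
  by move=> ->; ring.
by apply/funext => i; ring.
Qed.

Lemma sum_bounded_fset A u : (forall i, i \notin A -> u i = 0) ->
  sum_bounded u (\sum_(i <- A) cmod (u i)).
Proof.
move=> uA B; rewrite (big_fsetID _ (mem A))/= [X in _ + X]big1_fset ?addr0.
  apply: le_sum_fset => [i|]; first exact: cmod_ge0.
  by apply/fsubsetP => i; rewrite !inE => /andP[].
by move=> i; rewrite !inE => /andP[_ iA] _; rewrite uA// cmod0.
Qed.

Lemma csum_fset A u : (forall i, i \notin A -> u i = 0) ->
  csum u = \sum_(i <- A) u i.
Proof.
move=> uA; exact: csum_eq (sum_bounded_fset uA) (has_sum_fset uA).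
Qed.

(** No summability is required: negating a real family swaps the two sums in [rsum], whatever values
    [fine] gives them. The form can thus be treated as hermitian without checking convergence. *)
Lemma csum_conj u : csum (fun i => (u i)^*) = (csum u)^*.
Proof.
have rsumN (w : I -> R) : rsum (fun i => - w i) = - rsum w.
  by rewrite /rsum opprB; under [in X in _ - fine X]eq_fun do rewrite opprK.
rewrite /csum /= -rsumN; by congr complex.Complex; congr rsum;
  apply/funext => i; case: (u i).
Qed.

End UnconditionalSums.

(** Serves to reduce a sum over pairs supported on one row or column to a sum over vertices. *)
Lemma has_sum_inj (R : realType) (I J : choiceType) (h : J -> I)
    (u : I -> R[i]) (s : R[i]) : injective h ->
  (forall i, ~ range h i -> u i = 0) -> has_sum (u \o h) s -> has_sum u s.
Proof.
move=> hI u0 us e /us[A sA]; exists (h @` A)%fset => B AB.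
have finD : finite_set (h @^-1` [set` B]).
  by apply: finite_preimage => //; move=> ? ? _ _; exact: hI.
have memD j : (j \in fset_set (h @^-1` [set` B])) = (h j \in B).
  by rewrite in_fset_set//; apply/idP/idP; rewrite inE.
have AD : (A `<=` fset_set (h @^-1` [set` B]))%fset.
  apply/fsubsetP => j jA; rewrite memD; apply: (fsubsetP AB).
  by apply/imfsetP; exists j.
have := sA _ AD; rewrite [in X in X -> _]/=.
set D := fset_set _.
have <- : \sum_(i <- (h @` D)%fset) u i = \sum_(j <- D) u (h j).
  by rewrite big_imfset//= => ? ? _ _; exact: hI.
rewrite (big_fset_incl _ (B := B))//=.
  by apply/fsubsetP => i /imfsetP[j /=]; rewrite memD => ? ->.
move=> i iB; move/negP => hi; apply: u0 => -[j _ ji]; apply: hi.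
by apply/imfsetP; exists j => //=; rewrite memD ji.
Qed.

Lemma sum_bounded_inj (R : realType) (I J : choiceType) (k : J -> I)
    (u : I -> R[i]) (C : R) :
  injective k -> (forall i, ~ range k i -> u i = 0) ->
  sum_bounded (u \o k) C -> sum_bounded u C.
Proof.
move=> kI u0 uC B.
have [w0 wC] : (forall j, 0 <= cmod (u (k j))) /\
    forall D : {fset J}, \sum_(j <- D) cmod (u (k j)) <= C.
  by split=> [j|D]; [exact: cmod_ge0|exact: uC].
have hs := has_sum_nonneg w0 wC.
have u0' i : ~ range k i -> (cmod (u i))%:C = 0 by move=> /u0 ->; rewrite cmod0.
have hs' := has_sum_inj kI u0' hs.
rewrite (le_trans (has_sum_ge B (fun i => cmod_ge0 (u i)) hs'))//.
have := has_sum_le hs (C := C); rewrite cmod_real => le_C.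
rewrite (le_trans (ler_norm _))// le_C// => D.
by under eq_bigr do rewrite cmod_real ger0_norm ?cmod_ge0//; exact: wC.
Qed.

(** * Real-variable estimates: short time steps and log-convex sequences *)

Section RealLemmas.
Context {R : realType}.

Lemma powR_div (a C r : R) : 0 <= a -> 0 < C ->
  (a / C) `^ r = a `^ r / C `^ r.
Proof.
move=> a0 /ltW C0; rewrite powRM ?invr_ge0// -(powR_inv1 C0) powRAC.
by rewrite powR_inv1 ?powR_ge0.
Qed.

Lemma small_step (t d : R) : 0 < t -> 0 < d ->
  exists n : nat, exists s, [/\ 0 < s, s < d & n%:R * s = t].
Proof.
move=> t0 d0; pose n := Num.bound (t / d).
have tdn : t / d < n%:R by apply: archi_boundP; rewrite divr_ge0// ltW.
have n0 : 0 < n%:R :> R by rewrite (le_lt_trans _ tdn)// divr_ge0// ltW.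
exists n, (t / n%:R); split; first exact: divr_gt0.
  by rewrite ltr_pdivrMr// mulrC -ltr_pdivrMr.
by rewrite mulrC divfK// gt_eqF.
Qed.

(** Log-convexity makes the ratios [s n.+1 / s n] nondecreasing. If the first ratio r exceeded
    [kappa], the sequence would grow at least like r ^ n and outrun [E * kappa ^ n]. *)
Lemma log_convex_ratio (s : nat -> R) (E kappa : R) : (forall n, 0 <= s n) ->
  0 <= kappa -> (forall n, s n.+1 ^+ 2 <= s n * s n.+2) ->
  (forall n, s n <= E * kappa ^+ n) -> s 1%N <= kappa * s 0%N.
Proof.
move=> s0 k0 sconv sE; rewrite leNgt; apply/negP => lt_s1.
(* If [s 0] vanished, convexity at 0 would force [s 1] to vanish too, against [lt_s1]; so the ratio
   below is legitimate. *)
have s00 : 0 < s 0%N.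
  rewrite lt_neqAle s0 andbT eq_sym; apply/eqP => s0E.
  have := sconv 0%N; rewrite s0E mul0r => /le_trans/(_ (lexx _)).
  rewrite s0E mulr0 in lt_s1.
  by apply/negP; rewrite -ltNge exprn_gt0.
pose r := s 1%N / s 0%N.
have kr : kappa < r by rewrite ltr_pdivlMr.
have r0 : 0 < r by exact: le_lt_trans kr.
have growth n : 0 < s n /\ r * s n <= s n.+1.
  elim: n => [|n [sn IHn]]; first by rewrite s00 divfK// gt_eqF.
  have sn1 : 0 < s n.+1 by rewrite (lt_le_trans _ IHn)// mulr_gt0.
  split=> //; rewrite -(ler_pM2l sn) (le_trans _ (sconv n))// mulrCA mulrA expr2.
  by rewrite ler_pM2r.
have geom n : r ^+ n * s 0%N <= s n.
  elim: n => [|n IHn]; first by rewrite mul1r.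
  by rewrite exprS -mulrA (le_trans _ (growth n).2)// ler_pM2l.
have E0 : 0 < E by have := sE 0%N; rewrite mulr1; apply: lt_le_trans.
have q1 : `|kappa / r| < 1.
  by rewrite ger0_norm ?divr_ge0// ?ltr_pdivrMr ?mul1r// ltW.
have := cvg_expr q1 => /cvgrPdist_lt/(_ (s 0%N / E) (divr_gt0 s00 E0)).
case=> n _ /(_ n (leqnn n)) /=; rewrite sub0r normrN => qn.
have {}qn := le_lt_trans (ler_norm _) qn.
have := le_trans (geom n) (sE n).
apply/negP; rewrite -ltNge -ltr_pdivlMl ?exprn_gt0//.
have -> : E^-1 * (r ^+ n * s 0%N) = s 0%N / E * r ^+ n by ring.
by move: qn; rewrite expr_div_n ltr_pdivrMr// exprn_gt0.
Qed.

End RealLemmas.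

(** * Weighted l^p norms and duality *)

Section LebesgueNorms.
Context {R : realType} {X : countType} (m : X -> R).
Hypothesis m_gt0 : forall x, 0 < m x.
Implicit Types (f g h : X -> R[i]) (p q : \bar R) (A : {fset X}) (C D M r s : R).

Let m_ge0 x : 0 <= m x. Proof. exact: ltW. Qed.

Lemma esum_le_fset (I : choiceType) (w : I -> R) C : (forall i, 0 <= w i) ->
  (\esum_(i in [set: I]) (w i)%:E <= C%:E)%E <->
  (forall B : {fset I}, \sum_(i <- B) w i <= C).
Proof.
move=> w0; split=> [wC B|wC]; last first.
  apply: ge_ereal_sup => _ [B [finB _] <-].
  by rewrite fsbig_finite//= sumEFin lee_fin.
rewrite -lee_fin -sumEFin (le_trans _ wC)//.
apply: ereal_sup_ubound; exists [set` B] => //.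
by rewrite fsbig_finite//= set_fsetK.
Qed.

(** Real upper bounds replace the extended norm, so that estimates stay in real arithmetic. The sign
    of [C] is imposed separately because the sup norm over an empty [X] is -oo. *)
Definition lp_le p f C := 0 <= C /\ (lpnorm m p f <= C%:E)%E.

Lemma lp_le_ge0 p f C : lp_le p f C -> 0 <= C.
Proof. by case. Qed.

Lemma lp_le_finP r f C : 0 < r -> lp_le r%:E f C <->
  0 <= C /\ forall A, \sum_(x <- A) cmod (f x) `^ r * m x <= C `^ r.
Proof.
move=> r0; rewrite /lp_le /lpnorm.
have w0 x : 0 <= cmod (f x) `^ r * m x by rewrite mulr_ge0 ?powR_ge0.
rewrite -(esum_le_fset _ w0).
set E := esum _ _.
have : (0 <= E)%E by apply: esum_ge0 => x _; rewrite lee_fin.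
have ri0 : r^-1 != 0 by rewrite invr_eq0 gt_eqF.
case: E => [e| |]//= e0; last first.
  by rewrite (negbTE ri0).
split=> -[C0]; rewrite ?poweR_EFin !lee_fin => eC; split=> //.
  rewrite -[leLHS]powRr1// -(@mulVf _ r) ?gt_eqF// powRrM ge0_ler_powR ?nnegrE ?powR_ge0//.
  exact: ltW.
rewrite -[leRHS]powRr1// -(@mulfV _ r) ?gt_eqF// powRrM.
by rewrite ge0_ler_powR ?nnegrE ?powR_ge0// invr_ge0 ltW.
Qed.

Lemma lp_le_ooP f C : lp_le +oo%E f C <-> 0 <= C /\ forall x, cmod (f x) <= C.
Proof.
split=> -[C0 fC]; split=> //.
  move=> x; rewrite -lee_fin (le_trans _ fC)//.
  by apply: ereal_sup_ubound; exists x.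
by apply: ge_ereal_sup => _ [x _ <-]; rewrite lee_fin.
Qed.

Lemma lp_le_lp p f C : lp_le p f C -> lp m p f.
Proof. by case=> _ fC; rewrite /lp /= (le_lt_trans fC)// ltry. Qed.

Lemma lp_le_mono p f C D : lp_le p f C -> C <= D -> lp_le p f D.
Proof.
by move=> [C0 fC] CD; split; [exact: le_trans CD|rewrite (le_trans fC)// lee_fin].
Qed.

Lemma lpP p f : lp m p f -> exists C, lp_le p f C.
Proof.
rewrite /lp /= => fp; exists (Num.max 0 (fine (lpnorm m p f))).
split; first by rewrite le_max lexx.
move: fp; case: lpnorm => [e| |]//= _; last by rewrite leNye.
by rewrite lee_fin le_max lexx orbT.
Qed.

Lemma eq_lp_le p f g C : (forall x, cmod (f x) = cmod (g x)) ->
  lp_le p f C -> lp_le p g C.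
Proof.
rewrite /lp_le /lpnorm => fg; case: p => [r| |]//.
  by under eq_fun do rewrite fg.
by under eq_fun do rewrite fg.
Qed.

Lemma lp_le_conj p f C : lp_le p f C -> lp_le p (fun x => (f x)^*) C.
Proof. by apply: eq_lp_le => x; rewrite cmod_conj. Qed.

Lemma lp_leZ p f C (a : R[i]) : (1 <= p)%E ->
  lp_le p f C -> lp_le p (fun x => a * f x) (cmod a * C).
Proof.
have a0 := cmod_ge0 a.
case: p => [r| |]//; last first.
  move=> _ /lp_le_ooP[C0 fC]; apply/lp_le_ooP; rewrite mulr_ge0//; split=> // x.
  by rewrite cmodM ler_wpM2l.
rewrite lee_fin => r1; have r0 := lt_le_trans ltr01 r1.
move=> /(lp_le_finP _ _ r0)[C0 fC]; apply/(lp_le_finP _ _ r0).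
rewrite mulr_ge0//; split=> // A; rewrite powRM//.
under eq_bigr do rewrite cmodM powRM ?cmod_ge0// -mulrA.
by rewrite -mulr_sumr ler_wpM2l ?powR_ge0.
Qed.

Lemma lp_le0 p : (1 <= p)%E -> lp_le p (fun=> 0) 0.
Proof.
case: p => [r| |]//; last by move=> _; apply/lp_le_ooP; split=> // x; rewrite cmod0.
rewrite lee_fin => r1; have r0 := lt_le_trans ltr01 r1.
apply/(lp_le_finP _ _ r0); split=> // A.
by rewrite big1 ?powR_ge0// => x _; rewrite cmod0 powR0 ?mul0r// gt_eqF.
Qed.

(** The pair is oriented: norms with the second exponent, always finite, are recovered from pairings
    with the first, while sup-norm bounds are read off pointwise. *)
Variant dual_exponents : \bar R -> \bar R -> Prop :=
| DualFin r s of 0 < r & 0 < s & r^-1 + s^-1 = 1 : dual_exponents r%:E s%:E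
| DualOo : dual_exponents +oo%E 1%:E.

Lemma dual_exponents22 : dual_exponents 2%:E 2%:E.
Proof. by apply: DualFin => //; lra. Qed.

Lemma dual_exponents_ge1 p q : dual_exponents p q -> (1 <= p)%E /\ (1 <= q)%E.
Proof.
case=> [r s r0 s0 rs|]; last by rewrite leey.
rewrite !lee_fin.
have ri : 0 < r^-1 by rewrite invr_gt0.
have si : 0 < s^-1 by rewrite invr_gt0.
by split; rewrite -invf_le1//; lra.
Qed.

Lemma dual_exponents_fin s : 1 <= s -> exists p, dual_exponents p s%:E.
Proof.
rewrite le_eqVlt => /predU1P[<-|s1]; first by exists +oo%E; constructor.
have s0 := lt_trans ltr01 s1.
exists (1 - s^-1)^-1%:E; apply: DualFin; rewrite // ?invrK ?subrK//.
by rewrite invr_gt0 subr_gt0 invf_lt1.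
Qed.

Lemma dual_exponents_ge2 p : (2%:E <= p)%E ->
  exists s, [/\ dual_exponents p s%:E, 1 <= s & s <= 2].
Proof.
case: p => [r| |]//; last by exists 1; split; [constructor| |rewrite ler1n].
rewrite lee_fin => r2; have r0 : 0 < r by rewrite (lt_le_trans _ r2).
have ri : 0 < r^-1 by rewrite invr_gt0.
have ri2 : r^-1 <= 2^-1 by rewrite lef_pV2 ?posrE.
exists (1 - r^-1)^-1; split.
- by apply: DualFin; rewrite // ?invr_gt0 ?invrK; lra.
- by rewrite invf_ge1; lra.
- by rewrite -[leRHS]invrK lef_pV2 ?posrE; rewrite ?invr_gt0; lra.
Qed.

(** Bilinear, without conjugation: the transpose of L - z is again L - z, with the same z. *)
Definition pairing f g : R[i] := csum (fun x => f x * g x * (m x)%:C).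

Lemma pairingC f g : pairing f g = pairing g f.
Proof. by congr csum; apply/funext => x; rewrite [f x * _]mulrC. Qed.

Definition paired f g := exists C, sum_bounded (fun x => f x * g x * (m x)%:C) C.

Lemma pairedC f g : paired f g -> paired g f.
Proof. by move=> [C fg]; exists C => A; under eq_bigr do rewrite [g _ * _]mulrC. Qed.

Lemma pairing_linear (a : R[i]) f g h : paired f h -> paired g h ->
  pairing (fun x => a * f x + g x) h = a * pairing f h + pairing g h.
Proof.
move=> [C fh] [D gh]; rewrite /pairing -(csum_linear a fh gh); congr csum.
by apply/funext => x; ring.
Qed.

Lemma pairing_conj f g :
  pairing (fun x => (f x)^*) (fun x => (g x)^*) = (pairing f g)^*.
Proof.
rewrite /pairing -csum_conj; congr csum; apply/funext => x.
by rewrite -[in LHS](conjc_real (m x)) !rmorphM.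
Qed.

Lemma lp_le_eq0 r f x : 0 < r -> lp_le r%:E f 0 -> f x = 0.
Proof.
move=> r0 /(lp_le_finP _ _ r0)[_ /(_ [fset x]%fset)].
rewrite big_seq_fset1 powR0 ?gt_eqF// => fx.
have {}fx : cmod (f x) `^ r * m x = 0.
  by apply/eqP; rewrite eq_le fx mulr_ge0 ?powR_ge0.
move/eqP : fx; rewrite mulf_eq0 [m x == 0]gt_eqF// orbF powR_eq0 cmod_eq0.
by case/andP => /eqP.
Qed.

Lemma hoelder_bounded p q f g C D : dual_exponents p q ->
  lp_le p f C -> lp_le q g D ->
  sum_bounded (fun x => f x * g x * (m x)%:C) (C * D).
Proof.
have cmodE x : cmod (f x * g x * (m x)%:C) = cmod (f x) * cmod (g x) * m x.
  by rewrite !cmodM cmod_real ger0_norm.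
case=> [r s r0 s0 rs|] fC gD A; (under eq_bigr do rewrite cmodE); last first.
  have /lp_le_ooP[C0 {}fC] := fC.
  have /(lp_le_finP _ _ ltr01)[D0 /(_ A)] := gD; rewrite powRr1// => {}gD.
  rewrite (le_trans _ (ler_wpM2l C0 gD))// mulr_sumr ler_sum// => x _.
  by rewrite powRr1 ?cmod_ge0// mulrA !ler_wpM2r ?cmod_ge0.
have [C0 fC'] := (lp_le_finP f C r0).1 fC.
have [D0 gD'] := (lp_le_finP g D s0).1 gD.
(* Young's inequality below is applied to f / C and g / D. A zero bound is handled apart: it makes
   the function vanish, since [m] is positive. *)
have [Cz|Cz] := eqVneq C 0.
  rewrite big1 ?mulr_ge0// => x _; rewrite Cz in fC.
  by rewrite (lp_le_eq0 _ r0 fC) cmod0 !mul0r.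
have [Dz|Dz] := eqVneq D 0.
  rewrite big1 ?mulr_ge0// => x _; rewrite Dz in gD.
  by rewrite (lp_le_eq0 _ s0 gD) cmod0 mulr0 mul0r.
have {Cz} C1 : 0 < C by rewrite lt_neqAle eq_sym Cz.
have {Dz} D1 : 0 < D by rewrite lt_neqAle eq_sym Dz.
have young x : cmod (f x) * cmod (g x) * m x <= C * D *
    (r^-1 * (C `^ r)^-1 * (cmod (f x) `^ r * m x) +
     s^-1 * (D `^ s)^-1 * (cmod (g x) `^ s * m x)).
  have fx := divr_ge0 (cmod_ge0 (f x)) C0.
  have gx := divr_ge0 (cmod_ge0 (g x)) D0.
  have := conjugate_powR fx gx r0 s0 rs.
  rewrite !powR_div ?cmod_ge0// => young.
  have := ler_wpM2r (mulr_ge0 (mulr_ge0 C0 D0) (m_ge0 x)) young.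
  rewrite (_ : _ / _ * (_ / _) * _ = cmod (f x) * cmod (g x) * m x); last first.
    by field; rewrite !gt_eqF.
  by move/le_trans; apply; rewrite le_eqVlt; apply/orP; left; apply/eqP; ring.
(* Each of the two normalised sums is at most 1, so the bracket totals at most r^-1 + s^-1 = 1. *)
apply: (le_trans (ler_sum _ (fun x _ => young x))).
have ri0 : 0 <= r^-1 by rewrite invr_ge0 ltW.
have si0 : 0 <= s^-1 by rewrite invr_ge0 ltW.
rewrite -mulr_sumr ler_piMr ?mulr_ge0// big_split/= -!mulr_sumr -rs lerD//.
  rewrite -mulrA ler_piMr//.
  by rewrite ler_pdivrMl ?powR_gt0// mulr1.
rewrite -mulrA ler_piMr//.
by rewrite ler_pdivrMl ?powR_gt0// mulr1.
Qed.

Lemma hoelder p q f g C D : dual_exponents p q ->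
  lp_le p f C -> lp_le q g D -> cmod (pairing f g) <= C * D.
Proof. by move=> pq fC gD; apply: csum_le; apply: hoelder_bounded pq fC gD. Qed.

Lemma paired_lp p q f g : dual_exponents p q -> lp m p f -> lp m q g -> paired f g.
Proof.
move=> pq /lpP[C fC] /lpP[D gD]; exists (C * D); exact: hoelder_bounded pq fC gD.
Qed.

Definition fsupp A (w : X -> R[i]) x := if x \in A then w x else 0.

Lemma Cc_fsupp A f : Cc (fsupp A f).
Proof.
apply: (@sub_finite_set _ _ [set` A]) => // x /=; rewrite /fsupp.
by case: ifP => //; rewrite eqxx.
Qed.

Lemma CcP f : Cc f -> exists A, forall x, x \notin A -> f x = 0.
Proof.
move=> ff; exists (fset_set [set x | f x != 0]) => x.
by rewrite in_fset_set// notin_setE /= => /negP/negPn/eqP.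
Qed.

Lemma pairing_fset A f g : (forall x, x \notin A -> f x = 0) ->
  pairing f g = \sum_(x <- A) f x * g x * (m x)%:C.
Proof. by move=> fA; apply: csum_fset => x /fA ->; rewrite !mul0r. Qed.

Lemma paired_fset A f g : (forall x, x \notin A -> f x = 0) -> paired f g.
Proof.
move=> fA; eexists; apply: (@sum_bounded_fset _ _ A) => x /fA ->.
by rewrite !mul0r.
Qed.

(* The test functions attaining the dual norm are the conjugate phases of w
   times [cmod w `^ (s - 1)], cut off to finite sets. *)
Lemma dual_norm_le p q w M : dual_exponents p q -> 0 <= M ->
  (forall g C, Cc g -> lp_le p g C -> cmod (pairing g w) <= M * C) ->
  lp_le q w M.
Proof.
move=> pq M0 wM.
have [s qs [s0 pqs]] : exists2 s, q = s%:E & 0 < s /\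
    (p = +oo%E /\ s = 1 \/ exists r, [/\ p = r%:E, 0 < r & r^-1 + s^-1 = 1]).
  case: pq {wM} => [r s r0 s0 rs|]; last by exists 1 => //; split=> //; left.
  by exists s => //; split=> //; right; exists r.
rewrite {}qs in pq *.
apply/(lp_le_finP _ _ s0); split=> // A.
pose phase z : R[i] := z^* / (cmod z)%:C.
have cmod_phase z : z != 0 -> cmod (phase z) = 1.
  move=> z0; rewrite /phase -fmorphV cmodM cmod_real cmod_conj ger0_norm.
    by rewrite mulfV// cmod_eq0.
  by rewrite invr_ge0 cmod_ge0.
have phaseM z : phase z * z = (cmod z)%:C.
  rewrite /phase mulrAC [_ * z]mulrC mulc_conj expr2 rmorphM /=.
  have [->|z0] := eqVneq z 0; first by rewrite cmod0 !mul0r.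
  by rewrite mulfK// (inj_eq (@complexI _)) cmod_eq0.
pose g := fsupp A (fun x => phase (w x) * (cmod (w x) `^ (s - 1))%:C).
(* Pairing the test function with [w] returns exactly S, so it remains to bound the norm of [g] in
   terms of S. *)
pose S := \sum_(x <- A) cmod (w x) `^ s * m x.
have S0 : 0 <= S by apply: sumr_ge0 => x _; rewrite mulr_ge0 ?powR_ge0.
have gw : pairing g w = S%:C.
  rewrite (@pairing_fset A) => [|x /negbTE xA]; last by rewrite /g /fsupp xA.
  rewrite /S rmorph_sum; apply: eq_big_seq => x xA.
  rewrite /g /fsupp xA [_ * w x]mulrAC phaseM -!rmorphM /=; congr (_ * _)%:C.
  by rewrite mulr_powRB1 ?cmod_ge0.
have cmod_g x : cmod (g x) <= cmod (w x) `^ (s - 1).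
  rewrite /g /fsupp; case: ifP => _; last by rewrite cmod0 powR_ge0.
  rewrite cmodM cmod_real ger0_norm ?powR_ge0//.
  have [->|/cmod_phase ->] := eqVneq (w x) 0; last by rewrite mul1r.
  by rewrite /phase cmodM cmod_conj cmod0 !mul0r powR_ge0.
have := wM g; rewrite gw cmod_real ger0_norm// => {}wM.
case: pqs => [[pE s1]|[r [pE r0 rs]]]; rewrite {}pE in pq wM.
  have {}wM : S <= M * 1.
    apply: wM; first exact: Cc_fsupp.
    by apply/lp_le_ooP; split=> // x; rewrite (le_trans (cmod_g x))// s1 subrr powRr0.
  by rewrite mulr1 in wM; rewrite -/S s1 powRr1.
(* By conjugacy |g| ^ r is at most |w| ^ s on A, so the r-norm of [g] is at most S ^ (1 / r) and S
   <= M * S ^ (1 / r). *)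
have srS : (s - 1) * r = s.
  have r_neq0 : r != 0 by rewrite gt_eqF.
  have s_neq0 : s != 0 by rewrite gt_eqF.
  have : s * r * (r^-1 + s^-1) = s * r by rewrite rs mulr1.
  rewrite mulrDr mulfK// mulrAC mulfV// mul1r => srE.
  by rewrite mulrBl mul1r -srE addrK.
have {}wM : S <= M * S `^ r^-1.
  apply: wM; first exact: Cc_fsupp.
  apply/(lp_le_finP _ _ r0); rewrite powR_ge0; split=> // B.
  rewrite -powRrM mulVf ?gt_eqF// powRr1//.
  rewrite (@le_trans _ _ (\sum_(x <- B) (if x \in A then cmod (w x) `^ s * m x else 0)))//.
    apply: ler_sum => x _; have := cmod_g x; rewrite /g /fsupp; case: ifP => _ gx.
      have -> : cmod (w x) `^ s = (cmod (w x) `^ (s - 1)) `^ r.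
        by rewrite -powRrM srS.
      rewrite ler_wpM2r// ge0_ler_powR ?nnegrE ?cmod_ge0 ?powR_ge0//.
      exact: ltW.
    by rewrite cmod0 powR0 ?mul0r// gt_eqF.
  rewrite (big_fsetID _ (mem A))/= [X in _ + X]big1_fset ?addr0.
    rewrite (eq_big_seq (fun x => cmod (w x) `^ s * m x)) => [|x].
      apply: le_sum_fset => [x|]; first by rewrite mulr_ge0 ?powR_ge0.
      by apply/fsubsetP => x; rewrite !inE => /andP[].
    by rewrite !inE => /andP[_ /=] ->.
  by move=> x; rewrite !inE => /andP[_ /negbTE ->].
have [Sz|Sn0] := eqVneq S 0; first by rewrite -/S Sz powR_ge0.
have {Sn0}S1 : 0 < S by rewrite lt_neqAle eq_sym Sn0.
have {}wM : S `^ s^-1 <= M.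
  rewrite -(ler_pM2r (powR_gt0 r^-1 S1)) (le_trans _ wM)//.
  rewrite -powRD ?(addrC s^-1) ?rs ?powRr1//.
  by rewrite oner_eq0.
rewrite -/S -[leLHS]powRr1// -(@mulVf _ s) ?gt_eqF// powRrM.
by rewrite ge0_ler_powR ?nnegrE ?powR_ge0// ltW.
Qed.

(** Minkowski's inequality, obtained by duality for finite exponents: pairing with a finitely
    supported test function is additive, and [dual_norm_le] reads the norm back. *)
Lemma lp_leD p f g C D : (1 <= p)%E -> lp_le p f C -> lp_le p g D ->
  lp_le p (fun x => f x + g x) (C + D).
Proof.
move=> p1 fC gD; have C0 := lp_le_ge0 fC; have D0 := lp_le_ge0 gD.
case: p p1 fC gD => [s| |]// p1 fC gD; last first.
  move: fC gD => /lp_le_ooP[_ fC] /lp_le_ooP[_ gD].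
  apply/lp_le_ooP; rewrite addr_ge0//; split=> // x.
  by rewrite (le_trans (le_cmodD _ _))// lerD.
have [p' pq] := dual_exponents_fin p1.
apply: (dual_norm_le pq); first exact: addr_ge0.
move=> h E ch hE; have [A hA] := CcP ch.
have -> : pairing h (fun x => f x + g x) = pairing f h + pairing g h.
  rewrite pairingC -[pairing f h]mul1r -pairing_linear.
  - by under [in RHS]eq_fun do rewrite mul1r.
  - by apply: pairedC; apply: paired_fset hA.
  - by apply: pairedC; apply: paired_fset hA.
rewrite (le_trans (le_cmodD _ _))// mulrDl lerD// mulrC pairingC.
  exact: hoelder pq hE fC.
exact: hoelder pq hE gD.
Qed.

Lemma lp_leN p f C : lp_le p f C -> lp_le p (fun x => - f x) C.
Proof. by apply: eq_lp_le => x; rewrite cmodN. Qed.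

Lemma lp_leB p f g C D : (1 <= p)%E -> lp_le p f C -> lp_le p g D ->
  lp_le p (fun x => f x - g x) (C + D).
Proof. by move=> p1 fC /lp_leN gD; exact: lp_leD. Qed.

Lemma lp_linear p f g (a : R[i]) : (1 <= p)%E -> lp m p f -> lp m p g ->
  lp m p (fun x => a * f x + g x).
Proof.
move=> p1 /lpP[C fC] /lpP[D gD]; apply: lp_le_lp.
exact: lp_leD p1 (lp_leZ a p1 fC) gD.
Qed.

Lemma lp_conj p f : lp m p f -> lp m p (fun x => (f x)^*).
Proof. by move=> /lpP[C /lp_le_conj /lp_le_lp]. Qed.

Lemma Cc_lp p f : (1 <= p)%E -> Cc f -> lp m p f.
Proof.
move=> p1 /CcP[A fA]; case: p p1 => [r| |]//; rewrite ?lee_fin => r1; last first.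
  apply: (@lp_le_lp _ _ (\sum_(x <- A) cmod (f x))); apply/lp_le_ooP.
  have S0 : 0 <= \sum_(x <- A) cmod (f x) by apply: sumr_ge0 => x _; exact: cmod_ge0.
  split=> // x; have [xA|/fA ->] := boolP (x \in A); last by rewrite cmod0.
  rewrite -[leLHS](big_seq_fset1 +%R x (fun x => cmod (f x))).
  apply: le_sum_fset => [y|]; first exact: cmod_ge0.
  by rewrite fsub1set.
have r0 := lt_le_trans ltr01 r1.
have S0 : 0 <= \sum_(x <- A) cmod (f x) `^ r * m x.
  by apply: sumr_ge0 => x _; rewrite mulr_ge0 ?powR_ge0.
apply: (@lp_le_lp _ _ ((\sum_(x <- A) cmod (f x) `^ r * m x) `^ r^-1)).
apply/(lp_le_finP _ _ r0); rewrite powR_ge0; split=> // B.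
rewrite -powRrM mulVf ?gt_eqF// powRr1//.
rewrite (big_fsetID _ (mem A))/= [X in _ + X]big1_fset ?addr0.
  apply: le_sum_fset => [x|]; first by rewrite mulr_ge0 ?powR_ge0.
  by apply/fsubsetP => x; rewrite !inE => /andP[].
by move=> x; rewrite !inE => /andP[_ /fA ->] _; rewrite cmod0 powR0 ?mul0r ?gt_eqF.
Qed.

Definition point x : X -> R[i] := fsupp [fset x]%fset (fun=> 1).

Lemma pointE x y : point x y = if y == x then 1 else 0.
Proof. by rewrite /point /fsupp in_fset1. Qed.

Lemma point_out x y : y \notin [fset x]%fset -> point x y = 0.
Proof. by rewrite in_fset1 pointE => /negbTE ->. Qed.

Lemma cmod_point_le1 x y : cmod (point x y) <= 1.
Proof.
by rewrite pointE; case: eqP; rewrite ?cmod0// -[1]/(1%:C) cmod_real normr1.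
Qed.

Lemma point_sum A f : (forall x, x \notin A -> f x = 0) ->
  f = fun x => \sum_(y <- A) f y * point y x.
Proof.
move=> fA; apply/funext => x; have [xA|xA] := boolP (x \in A).
  rewrite (big_fsetD1 x)//= big1_fset => [|y].
    by rewrite addr0 pointE eqxx mulr1.
  by rewrite !inE => /andP[yx _] _; rewrite pointE eq_sym (negbTE yx) mulr0.
rewrite fA// big1_fset// => y yA _; rewrite pointE.
by case: eqP => [xy|_]; rewrite ?mulr0//; rewrite xy yA in xA.
Qed.

Lemma lp_dense r f : 1 <= r -> lp m r%:E f -> forall e, 0 < e ->
  exists A, lp_le r%:E (fun x => f x - fsupp A f x) e.
Proof.
move=> r1 /lpP[C]; have r0 := lt_le_trans ltr01 r1.
move=> /(lp_le_finP _ _ r0)[C0 fC] e e0.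
have w0 x : 0 <= cmod (f x) `^ r * m x by rewrite mulr_ge0 ?powR_ge0.
have e2 : 0 < e `^ r / 2 by rewrite divr_gt0// powR_gt0.
(* The partial sums over A and over any larger finite set lie within e ^ r / 2 of the total, so
   every finite tail outside A is at most e ^ r. *)
have [A sA] := has_sum_nonneg w0 fC e2; exists A.
apply/(lp_le_finP _ _ r0); split; first exact: ltW.
move=> B; rewrite (big_fsetID _ (mem A))/= big1_fset ?add0r; last first.
  move=> x; rewrite !inE => /andP[_ /= xA] _.
  by rewrite /fsupp xA subrr cmod0 powR0 ?mul0r ?gt_eqF.
set B' := [fset x in B | x \notin A]%fset.
have sAB := sA _ (fsubsetUl A B').
have := sA _ (fsubset_refl A); rewrite -!rmorph_sum -!rmorphB !cmod_real.
move: sAB; rewrite -rmorph_sum -rmorphB cmod_real.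
rewrite (big_fsetID _ (mem A) (A `|` B')%fset)/=.
rewrite (_ : [fset x in (A `|` B')%fset | x \in A]%fset = A); last first.
  by apply/fsetP => x; rewrite !inE; case: (x \in A); rewrite ?andbF.
rewrite (_ : [fset x in (A `|` B')%fset | x \notin A]%fset = B'); last first.
  by apply/fsetP => x; rewrite !inE; case: (x \in A); rewrite ?andbF ?andbT.
rewrite !ler_norml => /andP[h1 _] /andP[_ h2].
rewrite (_ : \sum_(x <- B') _ = \sum_(x <- B') cmod (f x) `^ r * m x).
  by lra.
apply: eq_big_seq => x; rewrite !inE => /andP[_ /negbTE xA].
by rewrite /fsupp xA subr0.
Qed.

Lemma lp_le_cvg0 r (F : R -> X -> R[i]) :
  (lpnorm m r%:E (F t) @[t --> 0^'+] --> 0%E) <->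
  forall e, 0 < e -> exists2 d, 0 < d & forall t, 0 < t -> t < d ->
    lp_le r%:E (F t) e.
Proof.
split=> [cvF e e0|cvF].
  have : \forall t \near 0^'+, (lpnorm m r%:E (F t) < e%:E)%E.
    apply: (cvF [set x | (x < e%:E)%E]); apply: open_nbhs_nbhs; split => //=.
    exact: open_ereal_lt_ereal.
  rewrite near_withinE => /nbhs_ballP[d /= d0 dF]; exists d => // t t0 td.
  split; first exact: ltW.
  apply/ltW/dF => //=; rewrite /ball /= sub0r normrN gtr0_norm//.
have ge0 t : (0 <= lpnorm m r%:E (F t))%E by exact: poweR_ge0.
have fin_num_le t (C : R) : (lpnorm m r%:E (F t) <= C%:E)%E ->
    lpnorm m r%:E (F t) \is a fin_num.
  by move=> FC; rewrite ge0_fin_numE// (le_lt_trans FC)// ltry.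
apply/fine_cvgP; split.
  have [d d0 dF] := cvF 1 ltr01.
  rewrite near_withinE; apply/nbhs_ballP; exists d => //= t.
  rewrite /ball /= sub0r normrN => td t0; rewrite gtr0_norm// in td.
  have [_ Fle] := dF t t0 td.
  exact: fin_num_le Fle.
apply/cvgrPdist_le => e e0; have [d d0 dF] := cvF e e0.
rewrite near_withinE; apply/nbhs_ballP; exists d => //= t.
rewrite /ball /= sub0r normrN => td t0; rewrite gtr0_norm// in td.
have [_ Fle] := dF t t0 td.
rewrite sub0r normrN ger0_norm; last exact: fine_ge0 (ge0 t).
by rewrite -lee_fin fineK//; exact: fin_num_le Fle.
Qed.

(** * Embeddings between l^p spaces when [m] is bounded below *)

Section Embedding.
Context (m0 : R) (m0_gt0 : 0 < m0) (m0_le1 : m0 <= 1) (le_m0 : forall x, m0 <= m x).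

(** A single term of the sum gives |f x| <= C / m0 ^ (1 / r). Since m0 <= 1 and r >= 1 this is at
    most C / m0, a constant that serves every exponent. *)
Lemma lp_le_pointwise p f C x : (1 <= p)%E -> lp_le p f C -> cmod (f x) <= C / m0.
Proof.
case: p => [r| |]//; last first.
  move=> _ /lp_le_ooP[C0 /(_ x) fx]; rewrite (le_trans fx)//.
  by rewrite ler_pdivlMr// ler_piMr.
rewrite lee_fin => r1; have r0 := lt_le_trans ltr01 r1.
move=> /(lp_le_finP _ _ r0)[C0 /(_ [fset x]%fset)]; rewrite big_seq_fset1 => fx.
have Cm : 0 <= C / m0 by rewrite divr_ge0// ltW.
rewrite leNgt; apply/negP => /(gt0_ltr_powR r0 Cm (cmod_ge0 (f x))).
apply/negP; rewrite -leNgt powR_div// ler_pdivlMr ?powR_gt0// (le_trans _ fx)//.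
rewrite ler_wpM2l ?powR_ge0// (le_trans _ (le_m0 x))//.
by rewrite ge1r_powR// m0_gt0.
Qed.

(** Splits |f| ^ s as |f| ^ (s - r) * |f| ^ r and bounds the first factor pointwise. *)
Lemma lp_embedding p q f C : (1 <= p)%E -> (p <= q)%E ->
  lp_le p f C -> lp_le q f (C / m0).
Proof.
move=> p1 pq fC; have C0 := lp_le_ge0 fC.
have Cm : 0 <= C / m0 by rewrite divr_ge0// ltW.
have fx x : cmod (f x) <= C / m0 := lp_le_pointwise x p1 fC.
have [qE|q_fin] := eqVneq q +oo%E; first by rewrite qE; apply/lp_le_ooP.
case: p q p1 pq fC q_fin => [r| |] [s| |]//; rewrite !lee_fin => r1 rs fC _.
have r0 := lt_le_trans ltr01 r1; have s0 := lt_le_trans r0 rs.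
have powD a : a `^ s = a `^ (s - r) * a `^ r.
  by rewrite -powRD subrK// gt_eqF.
have [_ {}fC] := (lp_le_finP _ _ r0).1 fC.
apply/(lp_le_finP _ _ s0); split=> // A; rewrite powD.
have CmC : C <= C / m0 by rewrite ler_pdivlMr// ler_piMr.
have {}fC : \sum_(x <- A) cmod (f x) `^ r * m x <= (C / m0) `^ r.
  by rewrite (le_trans (fC A))// ge0_ler_powR// ltW.
rewrite (le_trans _ (ler_wpM2l (powR_ge0 _ _) fC))// mulr_sumr ler_sum// => x _.
rewrite powD -mulrA ler_wpM2r ?mulr_ge0 ?powR_ge0//.
by rewrite ge0_ler_powR ?nnegrE ?cmod_ge0// subr_ge0.
Qed.

Lemma lp_subset p q f : (1 <= p)%E -> (p <= q)%E -> lp m p f -> lp m q f.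
Proof. by move=> p1 pq /lpP[C /(lp_embedding p1 pq) /lp_le_lp]. Qed.

End Embedding.

(** * Symmetric generators and their resolvents *)

Section SymmetricGenerator.
Context (T : R -> (X -> R[i]) -> (X -> R[i])).

Lemma semigroup_sub p t f g : lp_contraction_semigroup m p T -> 0 <= t ->
  lp m p f -> lp m p g -> T t (fun x => f x - g x) = (fun x => T t f x - T t g x).
Proof.
move=> Tp t0 fp gp.
have -> : (fun x => f x - g x) = (fun x => -1 * g x + f x).
  by apply/funext => x; ring.
by rewrite (semigroup_linear Tp)//; apply/funext => x; ring.
Qed.

Lemma semigroupZ p t f (a : R[i]) : lp_contraction_semigroup m p T -> 0 <= t ->
  lp m p f -> T t (fun x => a * f x) = (fun x => a * T t f x).
Proof.
move=> Tp t0 fp.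
have -> : (fun x => a * f x) = (fun x => (a - 1) * f x + f x).
  by apply/funext => x; ring.
by rewrite (semigroup_linear Tp)//; apply/funext => x; ring.
Qed.

Lemma semigroup_le p t f C : lp_contraction_semigroup m p T -> 0 <= t ->
  lp_le p f C -> lp_le p (T t f) C.
Proof.
move=> Tp t0 fC; have [C0 fC'] := fC; split=> //.
by rewrite (le_trans _ fC')// (semigroup_contraction Tp)//; exact: lp_le_lp fC.
Qed.

Definition quotient_error t f g x := (t^-1)%:C * (f x - T t f x) - g x.

Lemma generatorP r f g : generator m r%:E T f g <->
  [/\ lp m r%:E f, lp m r%:E g & forall e, 0 < e -> exists2 d, 0 < d &
    forall t, 0 < t -> t < d -> lp_le r%:E (quotient_error t f g) e].
Proof. by split=> -[fr gr /lp_le_cvg0 fg]; split=> //; apply/lp_le_cvg0. Qed.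

Lemma generator_linear r f f' g g' (a : R[i]) : (1 <= r%:E)%E ->
  lp_contraction_semigroup m r%:E T ->
  generator m r%:E T f f' -> generator m r%:E T g g' ->
  generator m r%:E T (fun x => a * f x + g x) (fun x => a * f' x + g' x).
Proof.
move=> r1 Tr /generatorP[fr f'r ff] /generatorP[gr g'r gg]; apply/generatorP.
split; [exact: lp_linear|exact: lp_linear|move=> e e0].
have a0 : 0 < cmod a + 1 by rewrite ltr_wpDl// cmod_ge0.
have [d d0 fd] := ff _ (divr_gt0 (divr_gt0 e0 (ltr0n R 2)) a0).
have [d' d'0 gd] := gg _ (divr_gt0 e0 (ltr0n R 2)).
exists (Num.min d d'); first by rewrite lt_min d0.
move=> t t0; rewrite lt_min => /andP[/(fd _ t0) {}fd /(gd _ t0) {}gd].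
have := lp_leD r1 (lp_leZ a r1 fd) gd.
have -> : quotient_error t (fun x => a * f x + g x) (fun x => a * f' x + g' x) =
    fun x => a * quotient_error t f f' x + quotient_error t g g' x.
  rewrite /quotient_error (semigroup_linear Tr)// ?ltW//.
  by apply/funext => x; ring.
move/lp_le_mono; apply.
rewrite [leRHS]splitr lerD// mulrCA ler_piMr ?divr_ge0// ?(ltW e0)//.
by rewrite ler_pdivrMr// mul1r lerDl.
Qed.

(** With contractivity, this keeps the quotient error along an orbit below its initial value, which
    makes the stepwise estimates uniform in the number of steps. *)
Lemma quotient_error_semigroup r s t f g : lp_contraction_semigroup m r%:E T ->
  (1 <= r%:E)%E -> 0 <= s -> 0 <= t -> lp m r%:E f -> lp m r%:E g ->
  quotient_error t (T s f) (T s g) = T s (quotient_error t f g).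
Proof.
move=> Tr r1 s0 t0 fr gr; have Tf := semigroup_lp Tr t0 fr.
have fTf : lp m r%:E (fun x => f x - T t f x).
  move: fr Tf => /lpP[C fC] /lpP[D TD].
  exact: lp_le_lp (lp_leB r1 fC TD).
rewrite /quotient_error.
rewrite (semigroup_sub Tr)//; last first.
  by move/lpP : fTf => [C /(lp_leZ (t^-1)%:C r1) /lp_le_lp].
rewrite (semigroupZ _ Tr)// (semigroup_sub Tr)//.
by rewrite -!(semigroupD Tr)// addrC.
Qed.

Lemma generator_semigroup r t f g : lp_contraction_semigroup m r%:E T ->
  (1 <= r%:E)%E -> 0 <= t -> generator m r%:E T f g -> generator m r%:E T (T t f) (T t g).
Proof.
move=> Tr r1 t0 /generatorP[fr gr fg]; apply/generatorP.
split; [exact: semigroup_lp|exact: semigroup_lp|move=> e e0].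
have [d d0 fd] := fg e e0; exists d => // s s0 sd.
rewrite (quotient_error_semigroup Tr)// ?ltW//.
by apply: (semigroup_le Tr) => //; exact: fd.
Qed.

Let one_le2 : (1 : R) <= 2. Proof. by rewrite ler1n. Qed.
Let onee_le2 : (1%:E <= 2%:E :> \bar R)%E. Proof. by rewrite lee_fin. Qed.

Lemma paired2 f g : lp m 2%:E f -> lp m 2%:E g -> paired f g.
Proof. exact: paired_lp dual_exponents22. Qed.

Lemma hoelder2 f g C D : lp_le 2%:E f C -> lp_le 2%:E g D ->
  cmod (pairing f g) <= C * D.
Proof. exact: hoelder dual_exponents22. Qed.

Lemma pairing2_linear (a : R[i]) f g h : lp m 2%:E f -> lp m 2%:E g ->
  lp m 2%:E h -> pairing (fun x => a * f x + g x) h = a * pairing f h + pairing g h.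
Proof. by move=> f2 g2 h2; apply: pairing_linear; exact: paired2. Qed.

Lemma pairing2_sub f g h : lp m 2%:E f -> lp m 2%:E g -> lp m 2%:E h ->
  pairing (fun x => f x - g x) h = pairing f h - pairing g h.
Proof.
move=> f2 g2 h2; rewrite [RHS]addrC -mulN1r -pairing2_linear//.
by congr (pairing _ h); apply/funext => x; ring.
Qed.

Lemma pairing2Z (a : R[i]) f g : lp m 2%:E f -> lp m 2%:E g ->
  pairing (fun x => a * f x) g = a * pairing f g.
Proof.
move=> f2 g2; rewrite (_ : (fun x => _) = fun x => (a - 1) * f x + f x).
  by rewrite pairing2_linear//; ring.
by apply/funext => x; ring.
Qed.

Lemma lp_linear_eq0 (F : (X -> R[i]) -> R[i]) K :
  (forall f g, lp m 2%:E f -> lp m 2%:E g -> F (fun x => f x - g x) = F f - F g) ->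
  (forall f C, lp_le 2%:E f C -> cmod (F f) <= K * C) ->
  (forall f, Cc f -> F f = 0) -> forall f, lp m 2%:E f -> F f = 0.
Proof.
move=> FB FK F0 f f2; apply/eqP; rewrite -cmod_eq0 eq_le cmod_ge0 andbT.
apply/ler_addgt0Pr => e e0; rewrite add0r.
have K0 : 0 < `|K| + 1 by rewrite ltr_wpDl.
have [A fA] := lp_dense one_le2 f2 (divr_gt0 e0 K0).
have := FK _ _ fA; rewrite FB//; last exact: Cc_lp (Cc_fsupp _ _).
rewrite (F0 _ (Cc_fsupp A f)) subr0.
move/le_trans; apply; rewrite mulrCA ler_piMr ?(ltW e0)// ler_pdivrMr// mul1r.
by rewrite (le_trans (ler_norm _))// lerDl.
Qed.

Hypothesis T2 : lp_contraction_semigroup m 2%:E T.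
Hypothesis T2_cont : strongly_continuous m 2%:E T.
Local Notation L := (generator m 2%:E T).
Hypothesis L_sym : forall f f' g g', L f f' -> L g g' -> pairing f' g = pairing f g'.
Hypothesis L_Cc : forall f, Cc f -> exists f', L f f'.

Lemma generator2_lp f g : L f g -> lp m 2%:E f /\ lp m 2%:E g.
Proof. by case. Qed.

(** To first order T_s w is w - s w'. In the difference of the pairings the terms of order zero
    cancel, and those of order one cancel by [L_sym]; only the quotient errors survive, with a
    factor s. *)
Lemma semigroup_step_symmetric s u u' v v' Cu Cv du dv : 0 < s ->
  L u u' -> L v v' -> lp_le 2%:E u Cu -> lp_le 2%:E v Cv ->
  lp_le 2%:E (quotient_error s u u') du -> lp_le 2%:E (quotient_error s v v') dv ->
  cmod (pairing (T s u) v - pairing u (T s v)) <= s * (du * Cv + Cu * dv).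
Proof.
move=> s0 Lu Lv uC vC ud vd; have sn0 : s%:C != 0 by rewrite (inj_eq (@complexI _)) gt_eqF.
have s0' := ltW s0.
have [u2 u'2] := generator2_lp Lu; have [v2 v'2] := generator2_lp Lv.
have Tu2 := semigroup_lp T2 s0' u2; have Tv2 := semigroup_lp T2 s0' v2.
have eu2 := lp_le_lp ud; have ev2 := lp_le_lp vd.
have TE w w' : T s w = fun x => - s%:C * quotient_error s w w' x + (- s%:C * w' x + w x).
  by apply/funext => x; rewrite /quotient_error fmorphV /=; field.
have pTE w w' k : lp m 2%:E w -> lp m 2%:E w' ->
    lp m 2%:E (quotient_error s w w') -> lp m 2%:E k ->
    pairing (T s w) k = - s%:C * pairing (quotient_error s w w') k +
      (- s%:C * pairing w' k + pairing w k).
  move=> w2 w'2 e2 k2; rewrite (TE w w') pairing_linear; first last.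
  - exact: paired2 (lp_linear _ onee_le2 w'2 w2) k2.
  - exact: paired2.
  by congr (_ + _); apply: pairing_linear; exact: paired2.
have -> : pairing (T s u) v - pairing u (T s v) =
    s%:C * (pairing (quotient_error s v v') u - pairing (quotient_error s u u') v).
  rewrite (pairingC u) (pTE u u')// (pTE v v')//.
  by rewrite (pairingC v u) (pairingC v' u) (L_sym Lu Lv); ring.
rewrite cmodM cmod_real ger0_norm// ler_wpM2l// (le_trans (le_cmodB _ _))//.
by rewrite addrC lerD// 1?[Cu * _]mulrC; exact: hoelder2.
Qed.

(** Moves T_s across the pairing one step at a time, through the intermediate pairing of T_(ns) u
    with T_s v. The induction replaces v by T_s v, hence the generality in [v] and [v'];
    contractivity leaves [Cv] and [dv] unchanged. *)
Lemma semigroup_steps_symmetric s n u u' v v' Cu Cv du dv : 0 < s ->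
  L u u' -> L v v' -> lp_le 2%:E u Cu -> lp_le 2%:E v Cv ->
  lp_le 2%:E (quotient_error s u u') du -> lp_le 2%:E (quotient_error s v v') dv ->
  cmod (pairing (T (n%:R * s) u) v - pairing u (T (n%:R * s) v)) <=
    n%:R * s * (du * Cv + Cu * dv).
Proof.
move=> s0 Lu + uC + ud; elim: n v v' => [|n IHn] v v' Lv vC vd.
  by rewrite !mul0r !(semigroup0 T2) ?subrr ?cmod0//; case: Lu Lv => ? _ _ [].
have s0' := ltW s0; have ns0 : 0 <= n%:R * s by rewrite mulr_ge0.
have [u2 u'2] := generator2_lp Lu; have [v2 v'2] := generator2_lp Lv.
have nE : n.+1%:R * s = n%:R * s + s by rewrite -natr1 mulrDl mul1r.
have -> : T (n.+1%:R * s) u = T s (T (n%:R * s) u).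
  by rewrite nE addrC (semigroupD T2).
have -> : T (n.+1%:R * s) v = T (n%:R * s) (T s v) by rewrite nE (semigroupD T2).
rewrite nE mulrDl [leRHS]addrC.
rewrite -[_ - _](subrKA (pairing (T (n%:R * s) u) (T s v))) (le_trans (le_cmodD _ _))//.
rewrite lerD//.
  apply: (semigroup_step_symmetric s0 (generator_semigroup T2 onee_le2 ns0 Lu) Lv
    (semigroup_le T2 ns0 uC) vC _ vd).
  rewrite (quotient_error_semigroup T2 onee_le2 ns0 s0' u2 u'2).
  exact: semigroup_le ud.
apply: (IHn _ _ (generator_semigroup T2 onee_le2 s0' Lv) (semigroup_le T2 s0' vC)).
rewrite (quotient_error_semigroup T2 onee_le2 s0' s0' v2 v'2).
exact: semigroup_le vd.
Qed.

Lemma semigroup_symmetric_Cc t u v : 0 <= t -> Cc u -> Cc v ->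
  pairing (T t u) v = pairing u (T t v).
Proof.
rewrite le_eqVlt => /predU1P[<- cu cv|t0 cu cv].
  by rewrite !(semigroup0 T2)//; exact: Cc_lp.
have [u' Lu] := L_Cc cu; have [v' Lv] := L_Cc cv.
have /lpP[Cu uC] := Cc_lp onee_le2 cu; have /lpP[Cv vC] := Cc_lp onee_le2 cv.
have Cu0 := lp_le_ge0 uC; have Cv0 := lp_le_ge0 vC.
apply/eqP; rewrite -subr_eq0 -cmod_eq0 eq_le cmod_ge0 andbT.
apply/ler_addgt0Pr => e e0; rewrite add0r.
(* With both quotient errors at most d, n steps of length t / n cost t * d * (Cu + Cv) in all. The
   choice of d makes this at most e, and the added 1 keeps the denominator positive. *)
have M0 : 0 < t * (Cu + Cv) + 1 by rewrite ltr_wpDl// mulr_ge0 ?addr_ge0// ltW.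
have d0 : 0 < e / (t * (Cu + Cv) + 1) by exact: divr_gt0.
have /generatorP[_ _ /(_ _ d0)[du du0 ud]] := Lu.
have /generatorP[_ _ /(_ _ d0)[dv dv0 vd]] := Lv.
have duv0 : 0 < Num.min du dv by rewrite lt_min du0.
have [n [s [s0]]] := small_step t0 duv0; rewrite lt_min => /andP[sdu sdv] nsE.
rewrite -nsE (le_trans (semigroup_steps_symmetric n s0 Lu Lv uC vC (ud _ s0 sdu) (vd _ s0 sdv)))//.
rewrite nsE; set M := t * _ + 1.
have -> : t * (e / M * Cv + Cu * (e / M)) = e * (t * (Cu + Cv) / M) by ring.
by rewrite ler_piMr ?(ltW e0)// ler_pdivrMr// mul1r lerDl.
Qed.

Lemma semigroup_symmetric t f g : 0 <= t -> lp m 2%:E f -> lp m 2%:E g ->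
  pairing (T t f) g = pairing f (T t g).
Proof.
move=> t0 f2 g2; have T2lp := semigroup_lp T2 t0.
(* Density is used in two passes: on the left argument while the right one is finitely supported,
   then on the right argument. *)
have sym h k : lp m 2%:E h -> Cc k -> pairing (T t h) k - pairing h (T t k) = 0.
  move=> + ck; have k2 := Cc_lp onee_le2 ck; have [D kD] := lpP k2.
  move: h; apply: (@lp_linear_eq0 _ (D + D)) => [h h' h2 h'2|h C hC|h ch].
  - by rewrite (semigroup_sub T2)// !pairing2_sub; auto; ring.
  - rewrite (le_trans (le_cmodB _ _))// mulrDl lerD// [leRHS]mulrC.
      by apply: hoelder2 => //; exact: semigroup_le hC.
    by apply: hoelder2 => //; exact: semigroup_le kD.
  - by rewrite (semigroup_symmetric_Cc t0 ch ck) subrr.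
apply/eqP; rewrite -subr_eq0 pairingC [pairing f _]pairingC; apply/eqP.
have [D fD] := lpP f2; move: g g2.
apply: (@lp_linear_eq0 _ (D + D)) => [h h' h2 h'2|h C hC|h ch].
- by rewrite (semigroup_sub T2)// !pairing2_sub; auto; ring.
- rewrite (le_trans (le_cmodB _ _))// mulrDl lerD// [leRHS]mulrC.
    by apply: hoelder2 => //; exact: semigroup_le fD.
  by apply: hoelder2 => //; exact: semigroup_le hC.
- by rewrite pairingC [pairing (T t h) f]pairingC sym.
Qed.

Lemma strong_continuityP r : strongly_continuous m r%:E T <->
  forall f, lp m r%:E f -> forall e, 0 < e -> exists2 d, 0 < d &
    forall t, 0 < t -> t < d -> lp_le r%:E (fun x => T t f x - f x) e.
Proof. by split=> Tc f /Tc /lp_le_cvg0. Qed.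

(* Telescoping [u - T (n * s) u] and moving the generator onto [w] replaces the
   integral identity [u - T t u = \int_0^t T r (L u) dr]. *)
Lemma weak_generator_steps w k u u' n s Cw Cu d e : 0 < s ->
  lp m 2%:E k -> (forall v v', L v v' -> pairing w v' = pairing k v) ->
  L u u' -> lp_le 2%:E w Cw -> lp_le 2%:E u Cu ->
  lp_le 2%:E (quotient_error s u u') d ->
  (forall j, (j < n)%N -> lp_le 2%:E (fun x => T (j%:R * s) k x - k x) e) ->
  cmod (pairing (fun x => u x - T (n%:R * s) u x) w - (n%:R * s)%:C * pairing u k)
    <= n%:R * s * (d * Cw + e * Cu).
Proof.
move=> s0 k2 weak Lu wC uC ud; have s0' := ltW s0.
have [u2 u'2] := generator2_lp Lu; have w2 := lp_le_lp wC; have e2 := lp_le_lp ud.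
elim: n => [_|n IHn ke].
  rewrite mul0r !mul0r subr0 (semigroup0 T2)//.
  by rewrite pairing2_sub// subrr cmod0.
have ns0 : 0 <= n%:R * s by rewrite mulr_ge0.
have nE : n.+1%:R * s = n%:R * s + s by rewrite -natr1 mulrDl mul1r.
have /IHn {}IHn : forall j, (j < n)%N ->
    lp_le 2%:E (fun x => T (j%:R * s) k x - k x) e by move=> j jn; apply: ke; exact: ltnW.
have Tu2 := semigroup_lp T2 ns0 u2; have Tu'2 := semigroup_lp T2 ns0 u'2.
have Te2 := semigroup_lp T2 ns0 e2; have Tk2 := semigroup_lp T2 ns0 k2.
have TnE : T (n.+1%:R * s) u = fun x => T (n%:R * s) u x -
    (s%:C * T (n%:R * s) (quotient_error s u u') x + s%:C * T (n%:R * s) u' x).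
  rewrite nE addrC (semigroupD T2)// -(quotient_error_semigroup T2)//.
  have sn0 : s%:C != 0 by rewrite (inj_eq (@complexI _)) gt_eqF.
  by apply/funext => x; rewrite /quotient_error fmorphV /=; field.
have ks2 : lp m 2%:E (fun x => T (n%:R * s) k x - k x) by apply: lp_le_lp (ke n _).
have key : pairing (fun x => u x - T (n.+1%:R * s) u x) w - (n.+1%:R * s)%:C * pairing u k =
    (pairing (fun x => u x - T (n%:R * s) u x) w - (n%:R * s)%:C * pairing u k) +
    s%:C * (pairing (T (n%:R * s) (quotient_error s u u')) w +
            pairing (fun x => T (n%:R * s) k x - k x) u).
  have sT2 : lp m 2%:E (fun x => s%:C * T (n%:R * s) u' x).
    by move/lpP : Tu'2 => [C /(lp_leZ s%:C onee_le2) /lp_le_lp].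
  have sTe2 : lp m 2%:E (fun x => s%:C * T (n%:R * s) (quotient_error s u u') x +
      s%:C * T (n%:R * s) u' x) by exact: lp_linear.
  have d2 : lp m 2%:E (fun x => T (n%:R * s) u x - (s%:C *
      T (n%:R * s) (quotient_error s u u') x + s%:C * T (n%:R * s) u' x)).
    by rewrite -TnE; apply: semigroup_lp => //; rewrite mulr_ge0.
  rewrite TnE !pairing2_sub// pairing2_linear//.
  rewrite (pairing2Z s%:C Tu'2 w2).
  (* The weak equation at T_(ns) u, which stays in the domain, followed by symmetry of T_(ns). *)
  have -> : pairing (T (n%:R * s) u') w = pairing (T (n%:R * s) k) u.
    rewrite pairingC (weak _ _ (generator_semigroup T2 onee_le2 ns0 Lu)).
    by rewrite -(semigroup_symmetric ns0 k2 u2).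
  by rewrite (pairingC k u) nE rmorphD /=; ring.
rewrite key nE mulrDl (le_trans (le_cmodD _ _))// lerD//.
rewrite cmodM cmod_real ger0_norm// ler_wpM2l// (le_trans (le_cmodD _ _))// lerD//.
  by apply: hoelder2 => //; exact: semigroup_le ud.
by apply: hoelder2 => //; exact: ke.
Qed.

(** Maximality of L, the substance of selfadjointness. Tested against u, the quotient error of [w]
    is nearly the average over r in [0, t] of the pairing of T_r k - k with u, and strong continuity
    at [k] makes this at most e times the norm of u. *)
Lemma weak_generator w k : lp m 2%:E w -> lp m 2%:E k ->
  (forall u u', L u u' -> pairing w u' = pairing k u) -> L w k.
Proof.
move=> w2 k2 weak; apply/generatorP; split=> // e e0.
have [Cw wC] := lpP w2.
have [d d0 kd] := (strong_continuityP 2).1 T2_cont k k2 e e0.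
exists d => // t t0 td.
have t0' := ltW t0; have Tw2 := semigroup_lp T2 t0' w2.
apply: (dual_norm_le dual_exponents22); first exact: ltW.
move=> u Cu cu uC; have [u' Lu] := L_Cc cu; have u2 := lp_le_lp uC.
have Tu2 := semigroup_lp T2 t0' u2.
have [_ _ Lu'] := (generatorP _ _ _).1 Lu.
have tn0 : t%:C != 0 by rewrite (inj_eq (@complexI _)) gt_eqF.
have -> : pairing u (quotient_error t w k) =
    (t^-1)%:C * (pairing (fun x => u x - T t u x) w - t%:C * pairing u k).
  have wTw2 : lp m 2%:E (fun x => w x - T t w x).
    move: w2 Tw2 => /lpP[C wC'] /lpP[D TD].
    exact: lp_le_lp (lp_leB onee_le2 wC' TD).
  have twTw2 : lp m 2%:E (fun x => (t^-1)%:C * (w x - T t w x)).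
    by move/lpP : wTw2 => [C /(lp_leZ (t^-1)%:C onee_le2) /lp_le_lp].
  rewrite pairingC /quotient_error (pairing2_sub twTw2 k2 u2) (pairing2Z _ wTw2 u2).
  rewrite !pairing2_sub// (semigroup_symmetric t0' w2 u2).
  rewrite (pairingC w u) (pairingC w (T t u)) (pairingC k u).
  by rewrite fmorphV /=; field.
rewrite cmodM cmod_real ger0_norm ?invr_ge0// ler_pdivrMl//.
(* The step length depends on u, while [d] must not. The discretisation error is therefore absorbed
   in an arbitrary e', with u fixed. *)
apply/ler_addgt0Pr => e' e'0.
have M0 : 0 < t * Cw + 1 by rewrite ltr_wpDl// mulr_ge0// (lp_le_ge0 wC).
have [d' d'0 ud] := Lu' _ (divr_gt0 e'0 M0).
have [n [s [s0 sd' nsE]]] := small_step t0 d'0.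
have := weak_generator_steps (n := n) s0 k2 weak Lu wC uC (ud _ s0 sd') (e := e).
rewrite nsE => /(_ _)/le_trans; apply.
  (* Time 0 is outside the range covered by strong continuity, but there the difference is exactly
     zero. *)
  case=> [|j] jn.
    rewrite mul0r (semigroup0 T2)//.
    apply: lp_le_mono (ltW e0).
    by apply: eq_lp_le (lp_le0 onee_le2) => x; rewrite subrr cmod0.
  apply: kd; first by rewrite mulr_gt0.
  by rewrite (le_lt_trans _ td)// -nsE ler_pM2r// ler_nat ltnW.
rewrite mulrDr addrC mulrA lerD2l.
set M := t * Cw + 1.
have -> : t * (e' / M * Cw) = e' * (t * Cw / M) by ring.
by rewrite ler_piMr ?(ltW e'0)// ler_pdivrMr// mul1r lerDl.
Qed.

(** * The squared l^2 norm and reality of the quadratic form *)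

Context (m0 : R) (m0_gt0 : 0 < m0) (m0_le1 : m0 <= 1) (le_m0 : forall x, m0 <= m x).
Hypothesis L_conj : forall f g, L f g -> L (fun x => (f x)^*) (fun x => (g x)^*).
Lemma generator2_linear (a : R[i]) f f' g g' : L f f' -> L g g' ->
  L (fun x => a * f x + g x) (fun x => a * f' x + g' x).
Proof. exact: generator_linear onee_le2 T2. Qed.

Definition norm2sq f : R := complex.Re (pairing f (fun x => (f x)^*)).

Lemma pairing_conj_self f : lp m 2%:E f ->
  pairing f (fun x => (f x)^*) = (norm2sq f)%:C.
Proof.
move=> f2; have fE : pairing f (fun x => (f x)^*) =
    csum (fun x => (cmod (f x) ^+ 2 * m x)%:C).
  by rewrite /pairing; congr csum; apply/funext => x; rewrite mulc_conj -rmorphM.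
rewrite /norm2sq fE /csum /rsum /=; apply/eqP; rewrite eq_complex /= eqxx /=.
by rewrite oppr0 subrr.
Qed.

Lemma norm2sq_ge_fset f A : lp m 2%:E f ->
  \sum_(x <- A) cmod (f x) ^+ 2 * m x <= norm2sq f.
Proof.
move=> f2; have [C fg] := paired2 f2 (lp_conj f2).
have fs := csum_has_sum fg.
rewrite -[csum _]/(pairing f (fun x => (f x)^*)) pairing_conj_self// in fs.
apply: has_sum_ge => [x|]; first by rewrite mulr_ge0 ?sqr_ge0.
rewrite (_ : (fun x => _) = fun x => f x * (f x)^* * (m x)%:C)//.
by apply/funext => x; rewrite mulc_conj -rmorphM.
Qed.

Lemma norm2sq_ge0 f : lp m 2%:E f -> 0 <= norm2sq f.
Proof. by move/(@norm2sq_ge_fset _ fset0); rewrite big_seq_fset0. Qed.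

Lemma lp_le_norm2sq f C : lp m 2%:E f ->
  lp_le 2%:E f C <-> 0 <= C /\ norm2sq f <= C ^+ 2.
Proof.
move=> f2; split=> [fC|[C0 fC]].
  split; first exact: lp_le_ge0 fC.
  have := hoelder2 fC (lp_le_conj fC); rewrite pairing_conj_self// cmod_real.
  by rewrite ger0_norm// norm2sq_ge0.
apply/lp_le_finP => //; split=> // A.
rewrite powR_mulrn// (le_trans _ fC)// (le_trans _ (norm2sq_ge_fset A f2))//.
by under eq_bigr do rewrite powR_mulrn ?cmod_ge0//.
Qed.

Lemma lp_le_sqrt_norm2sq f : lp m 2%:E f -> lp_le 2%:E f (Num.sqrt (norm2sq f)).
Proof.
move=> f2; apply/(lp_le_norm2sq _ f2); rewrite sqrtr_ge0 sqr_sqrtr//.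
exact: norm2sq_ge0.
Qed.

(** Symmetry of L against the conjugate of f identifies the value with its own conjugate. *)
Lemma generator2_pairing_real f g : L f g ->
  complex.Im (pairing g (fun x => (f x)^*)) = 0.
Proof.
move=> Lf; have := L_sym Lf (L_conj Lf).
rewrite [pairing f _]pairingC.
have -> : f = fun x => ((f x)^*)^* by apply/funext => x; rewrite conjcK.
rewrite pairing_conj.
under [X in pairing g X]eq_fun do rewrite conjcK.
by case: pairing => a d /= []; lra.
Qed.

(** * Solvability of (L - z) w = v and the resolvent set on l^2 *)

Section Resolvent.
Context (z : R[i]).

Lemma shifted_sym u g v h : L u (fun x => g x + z * u x) ->
  L v (fun x => h x + z * v x) -> lp m 2%:E g -> lp m 2%:E h ->
  pairing g v = pairing u h.
Proof.
move=> Lu Lv g2 h2; have [u2 u'2] := generator2_lp Lu.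
have [v2 v'2] := generator2_lp Lv; have := L_sym Lu Lv.
have comm w k : (fun x => k x + z * w x) = (fun x => z * w x + k x :> R[i]).
  by apply/funext => x; rewrite addrC.
rewrite !comm pairing2_linear// [RHS]pairingC pairing2_linear//.
by rewrite (pairingC v) (pairingC h) => /addrI.
Qed.

Lemma bounded_below_nonreal u g C : complex.Im z != 0 ->
  L u (fun x => g x + z * u x) -> lp_le 2%:E g C ->
  lp_le 2%:E u (`|complex.Im z|^-1 * C).
Proof.
move=> z0 Lu gC; have [u2 _] := generator2_lp Lu; have g2 := lp_le_lp gC.
have C0 := lp_le_ge0 gC; have uS := lp_le_sqrt_norm2sq u2.
have zi : 0 <= `|complex.Im z|^-1 by rewrite invr_ge0.
have := generator2_pairing_real Lu.
have -> : (fun x => g x + z * u x) = (fun x => z * u x + g x).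
  by apply/funext => x; rewrite addrC.
rewrite pairing2_linear//; last exact: lp_conj.
rewrite pairing_conj_self// => im0.
have {}im0 : complex.Im z * norm2sq u =
    - complex.Im (pairing g (fun x => (u x)^*)).
  move: im0; case: z => a b; case: pairing => c d /=.
  by rewrite mulr0 add0r => /eqP; rewrite addr_eq0 => /eqP.
set S := norm2sq u in im0 uS *.
have S0 : 0 <= S by exact: norm2sq_ge0.
have h1 : `|complex.Im z| * S <= C * Num.sqrt S.
  rewrite -[S in leLHS]ger0_norm// -normrM im0 normrN (le_trans (cmod_Im _))//.
  by apply: hoelder2 => //; exact: lp_le_conj.
apply: (lp_le_mono uS).
have [sS0|sS0] := eqVneq (Num.sqrt S) 0; first by rewrite sS0 mulr_ge0.
rewrite ler_pdivlMl ?normr_gt0//.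
have sS1 : 0 < Num.sqrt S by rewrite lt_neqAle eq_sym sS0 sqrtr_ge0.
by rewrite -(ler_pM2r sS1) -mulrA -expr2 sqr_sqrtr.
Qed.

Lemma krein_lax q K h : complex.Im z = 0 -> (1 <= q)%E -> (q <= 2%:E)%E -> 0 <= K ->
  (forall v, lp m q v -> exists2 w, L w (fun x => v x + z * w x) &
     forall D, lp_le q v D -> lp_le q w (K * D)) ->
  lp m q h -> exists2 w, L w (fun x => h x + z * w x) &
    forall C, lp_le 2%:E h C -> lp_le 2%:E w (K * C).
Proof.
move=> z_real q1 q2 K0 res hq.
(* Solutions are chosen on the subtype of l^q functions so that solving can be iterated. *)
have resS (v : {v | lp m q v}) : exists w : {w | lp m q w},
    L (sval w) (fun x => sval v x + z * sval w x) /\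
    forall D, lp_le q (sval v) D -> lp_le q (sval w) (K * D).
  case: v => v /= vq; have [w Lw wK] := res v vq; have [D vD] := lpP vq.
  by exists (exist _ w (lp_le_lp (wK D vD))).
have [S SP] := choice resS.
pose v n := sval (iter n S (exist _ h hq)).
have vq n : lp m q (v n) by exact: svalP.
have v2 n : lp m 2%:E (v n) := lp_subset m0_gt0 m0_le1 le_m0 q1 q2 (vq n).
have Lv n : L (v n.+1) (fun x => v n x + z * v n.+1 x) := (SP _).1.
have [D hD] := lpP hq.
have vD n : lp_le q (v n) (K ^+ n * D).
  elim: n => [|n IHn]; first by rewrite mul1r.
  by rewrite exprS -mulrA; exact: (SP _).2.
(* Since z is real, the conjugate of an iterate solves the conjugated equation with the same z, as
   the convexity step requires. *)
have zconj : z^* = z.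
  by move: z_real; case: z => a b /= ->; rewrite oppr0.
exists (v 1%N); first exact: Lv.
(* Log-convexity is applied to squared norms, so the rate is K ^ 2; the constant (D / m0) ^ 2 comes
   from embedding the l^q bound K ^ n * D into l^2. *)
have sqr_le : norm2sq (v 1%N) <= K ^+ 2 * norm2sq (v 0%N).
  apply: (@log_convex_ratio R (fun n => norm2sq (v n)) ((D / m0) ^+ 2)).
  - by move=> n; exact: norm2sq_ge0.
  - exact: sqr_ge0.
  - move=> n; have Lc : L (fun x => (v n.+2 x)^*)
        (fun x => (v n.+1 x)^* + z * (v n.+2 x)^*).
      have -> : (fun x => (v n.+1 x)^* + z * (v n.+2 x)^*) =
          fun x => (v n.+1 x + z * v n.+2 x)^*.
        by apply/funext => x; rewrite -[in LHS]zconj -rmorphM -rmorphD.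
      exact: L_conj (Lv n.+1).
    have := shifted_sym (Lv n) Lc (v2 n) (lp_conj (v2 n.+1)).
    rewrite pairing_conj_self// => vv.
    have := hoelder2 (lp_le_sqrt_norm2sq (v2 n))
      (lp_le_conj (lp_le_sqrt_norm2sq (v2 n.+2))).
    rewrite vv cmod_real ger0_norm ?norm2sq_ge0// => vle.
    rewrite -[leRHS]sqr_sqrtr ?mulr_ge0 ?norm2sq_ge0// sqrtrM ?norm2sq_ge0//.
    by rewrite ler_sqr ?nnegrE ?mulr_ge0 ?sqrtr_ge0 ?norm2sq_ge0.
  - move=> n; have := lp_embedding m0_gt0 m0_le1 le_m0 q1 q2 (vD n).
    move=> /(lp_le_norm2sq _ (v2 n))[_ le_n].
    by rewrite (le_trans le_n)// -mulrA exprMn -exprM mulnC exprM mulrC.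
move=> C /(lp_le_norm2sq _ (v2 0%N))[C0 hC].
apply/(lp_le_norm2sq _ (v2 1%N)); split; first exact: mulr_ge0.
by rewrite (le_trans sqr_le)// exprMn ler_wpM2l ?sqr_ge0.
Qed.

(** [krein_lax] bounds only solutions with data in l^q. For real z and arbitrary u in the domain,
    pairing a test function h with u equals pairing the solution for h with g, so the bound
    transfers by duality. *)
Lemma bounded_below q K : (1 <= q)%E -> (q <= 2%:E)%E -> 0 <= K ->
  (forall v, lp m q v -> exists2 w, L w (fun x => v x + z * w x) &
     forall D, lp_le q v D -> lp_le q w (K * D)) ->
  exists2 K', 0 <= K' & forall u g C,
    L u (fun x => g x + z * u x) -> lp_le 2%:E g C -> lp_le 2%:E u (K' * C).
Proof.
move=> q1 q2 K0 res; have [z0|z0] := eqVneq (complex.Im z) 0; last first.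
  exists `|complex.Im z|^-1; first by rewrite invr_ge0.
  by move=> u g C; exact: bounded_below_nonreal.
exists K => // u g C Lu gC; have C0 := lp_le_ge0 gC.
apply: (dual_norm_le dual_exponents22); first exact: mulr_ge0.
move=> h D ch hD.
have [w Lw wK] := krein_lax z0 q1 q2 K0 res (Cc_lp q1 ch).
rewrite (shifted_sym Lw Lu (lp_le_lp hD) (lp_le_lp gC)).
rewrite mulrAC; apply: hoelder2 gC; exact: wK.
Qed.

(* The transpose of the resolvent of [A] on l^p, tested against point masses,
   inverts [L - z] on l^q. *)
Lemma transpose_resolvent p q K (A : (X -> R[i]) -> (X -> R[i]) -> Prop) :
  dual_exponents p q -> (2%:E <= p)%E -> (q <= 2%:E)%E -> 0 <= K ->
  (forall (a : R[i]) f f' g g', A f f' -> A g g' ->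
     A (fun x => a * f x + g x) (fun x => a * f' x + g' x)) ->
  (forall f g, L f g -> A f g) ->
  (forall g, Cc g -> exists u, A u (fun x => g x + z * u x)) ->
  (forall u g C, A u (fun x => g x + z * u x) -> lp_le p g C -> lp_le p u (K * C)) ->
  forall v, lp m q v -> exists2 w, L w (fun x => v x + z * w x) &
    forall D, lp_le q v D -> lp_le q w (K * D).
Proof.
move=> pq p2 q2 K0 Alin LA Aex Ale v vq; have [p1 q1] := dual_exponents_ge1 pq.
have [gam gamP] := choice (fun y => Aex (point y) (Cc_fsupp _ _)).
have gamp y : lp m p (gam y).
  by have /lpP[C /(Ale _ _ _ (gamP y)) /lp_le_lp] := Cc_lp p1 (Cc_fsupp [fset y]%fset (fun=> 1)).
(* This value is forced: the point mass at x paired with w gives w x * m x, which transposition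
   requires to equal the pairing of [gam x] with v. *)
pose w x := pairing (gam x) v / (m x)%:C.
have transpose g : Cc g -> exists u, [/\ A u (fun x => g x + z * u x), lp m p u &
    pairing g w = pairing u v].
  move=> /CcP[B gB].
  have mE x : (m x)%:C != 0 :> R[i] by rewrite (inj_eq (@complexI _)) gt_eqF.
  have pw : pairing g w = \sum_(y <- B) g y * pairing (gam y) v.
    rewrite (pairing_fset _ gB); apply: eq_bigr => y _.
    by rewrite /w -mulrA divfK.
  have [u [Au up uv]] : exists u, [/\ A u (fun x => \sum_(y <- B) g y * point y x + z * u x),
      lp m p u & \sum_(y <- B) g y * pairing (gam y) v = pairing u v].
    elim: (enum_fset B) => [|y s [u [Au up uv]]].
      (* Closure under combinations does not by itself supply a pair in [A]. [L_Cc] provides one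
         over the zero function, and subtracting it from itself makes its value zero. *)
      exists (fun=> 0); rewrite big_nil; split.
      - have [k Lo] : exists k, L (fun=> 0) k.
          by apply: L_Cc; apply: (@sub_finite_set _ _ set0) => // x /=; rewrite eqxx.
        have := Alin (-1) _ _ _ _ (LA _ _ Lo) (LA _ _ Lo).
        have -> : (fun x => -1 * 0 + 0) = (fun=> 0) :> (X -> R[i]).
          by apply/funext => x; rewrite mulr0 addr0.
        have -> : (fun x => -1 * k x + k x) = (fun x => \sum_(y <- [::]) g y * point y x + z * 0).
          by apply/funext => x; rewrite big_nil; ring.
        by [].
      - exact: lp_le_lp (lp_le0 p1).
      - rewrite (@pairing_fset fset0) ?big_seq_fset0//.
    exists (fun x => g y * gam y x + u x); split.
    - have := Alin (g y) _ _ _ _ (gamP y) Au.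
      congr A; apply/funext => x; rewrite big_cons; ring.
    - exact: lp_linear.
    - rewrite big_cons pairing_linear ?uv//; exact: paired_lp pq _ vq.
  by exists u; split; rewrite ?pw// [in X in A _ X](point_sum gB).
have wK D : lp_le q v D -> lp_le q w (K * D).
  move=> vD; have D0 := lp_le_ge0 vD.
  apply: (dual_norm_le pq); first exact: mulr_ge0.
  move=> g C cg gC; have [u [Au up ->]] := transpose g cg.
  by rewrite mulrAC; exact: hoelder pq (Ale _ _ _ Au gC) vD.
exists w => //.
have [D vD] := lpP vq; have wq := wK D vD.
have v2 := lp_subset m0_gt0 m0_le1 le_m0 q1 q2 vq.
have w2 := lp_subset m0_gt0 m0_le1 le_m0 q1 q2 (lp_le_lp wq).
have vzw2 : lp m 2%:E (fun x => v x + z * w x).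
  rewrite (_ : (fun x => _) = fun x => z * w x + v x); first exact: lp_linear.
  by apply/funext => x; rewrite addrC.
(* It suffices to test against the domain of L; with g = (L - z) a the equation becomes
   [pairing g w = pairing a v]. *)
apply: weak_generator => // a a' La; have [a2 a'2] := generator2_lp La.
pose g x := a' x - z * a x.
have g2 : lp m 2%:E g.
  rewrite (_ : g = fun x => - z * a x + a' x); first exact: lp_linear.
  by apply/funext => x; rewrite /g; ring.
have [Cw wC] := lpP w2; have Cw0 := lp_le_ge0 wC; have D0 := lp_le_ge0 vD.
(* So far this is available for finitely supported g. The cut-off is made in l^2 and its smallness
   carried to l^p by the embedding, since finitely supported functions need not be dense in l^oo;
   [Ale] then controls a - u. *)
have gw : pairing g w = pairing a v.
  apply/eqP; rewrite -subr_eq0 -cmod_eq0 eq_le cmod_ge0 andbT.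
  apply/ler_addgt0Pr => r r0; rewrite add0r.
  (* [Cw] accounts for the truncation error paired with w, and [K / m0 * D] for a - u paired with
     v. *)
  pose M := Cw + K / m0 * D.
  have M0 : 0 <= M by rewrite addr_ge0// mulr_ge0// divr_ge0// ltW.
  have d0 : 0 < r / (M + 1) by rewrite divr_gt0// ltr_wpDl.
  have [B gB] := lp_dense one_le2 g2 d0.
  have [u [Au up uv]] := transpose _ (Cc_fsupp B g).
  have Aau : A (fun x => a x - u x) (fun x => (g x - fsupp B g x) + z * (a x - u x)).
    have := Alin (-1) _ _ _ _ Au (LA _ _ La); congr A; apply/funext => x.
      by rewrite mulN1r addrC.
    by rewrite /g; ring.
  have auK := Ale _ _ _ Aau (lp_embedding m0_gt0 m0_le1 le_m0 onee_le2 p2 gB).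
  have ap := lp_subset m0_gt0 m0_le1 le_m0 onee_le2 p2 a2.
  have -> : pairing g w - pairing a v = pairing (fun x => g x - fsupp B g x) w -
      pairing (fun x => a x - u x) v.
    have -> : pairing (fun x => a x - u x) v = pairing a v - pairing u v.
      rewrite [RHS]addrC -mulN1r -pairing_linear; first last.
      - exact: paired_lp pq _ vq.
      - exact: paired_lp pq _ vq.
      by congr (pairing _ v); apply/funext => x; rewrite mulN1r addrC.
    rewrite (pairing2_sub g2 (Cc_lp onee_le2 (Cc_fsupp B g)) w2).
    by rewrite uv; ring.
  rewrite (le_trans (le_cmodB _ _))// (le_trans (lerD (hoelder2 gB wC) (hoelder pq auK vD)))//.
  set d := r / (M + 1).
  have -> : d * Cw + K * (d / m0) * D = r * (M / (M + 1)) by rewrite /d /M; ring.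
  by rewrite ler_piMr ?(ltW r0)// ler_pdivrMr ?ltr_wpDl// mul1r lerDl.
have a'E : a' = fun x => z * a x + g x by apply/funext => x; rewrite /g; ring.
have vE : (fun x => v x + z * w x) = fun x => z * w x + v x.
  by apply/funext => x; rewrite addrC.
rewrite vE a'E pairingC !pairing2_linear// gw (pairingC a w) (pairingC a v).
by [].
Qed.

(** The hypothesis solves the equation for finitely supported data, and [bounded_below] bounds every
    solution in the domain. Transposition with [A] equal to L extends this to all l^2 data; the
    lower bound at zero data gives uniqueness. *)
Lemma resolvent_criterion q K : (1 <= q)%E -> (q <= 2%:E)%E -> 0 <= K ->
  (forall v, lp m q v -> exists2 w, L w (fun x => v x + z * w x) &
     forall D, lp_le q v D -> lp_le q w (K * D)) ->
  resolvent_set m 2%:E L z.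
Proof.
move=> q1 q2 K0 res; have [K' K'0 below] := bounded_below q1 q2 K0 res.
have res2 := transpose_resolvent dual_exponents22 (lexx _) (lexx _) K'0 (A := L)
  generator2_linear (fun _ _ => id).
exists K' => g g2.
have Lex h : Cc h -> exists u, L u (fun x => h x + z * u x).
  by move=> /(Cc_lp q1)/res[u Lu _]; exists u.
have [f Lf fK] := res2 Lex below g g2; exists f; split=> //.
  have [C gC] := lpP g2; have gfin : lpnorm m 2%:E g \is a fin_num.
    by rewrite ge0_fin_numE ?poweR_ge0.
  have gG : lp_le 2%:E g (fine (lpnorm m 2%:E g)).
    by split; [rewrite fine_ge0// poweR_ge0|rewrite fineK].
  have [_] := fK _ gG; by rewrite EFinM fineK.
move=> f' Lf'; have [f2 _] := generator2_lp Lf; have [f'2 _] := generator2_lp Lf'.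
have L0 : L (fun x => f' x - f x) (fun x => 0 + z * (f' x - f x)).
  have := generator2_linear (-1) Lf Lf'; congr (generator _ _ _); apply/funext => x.
    by rewrite mulN1r addrC.
  by ring.
have := below _ _ _ L0 (lp_le0 onee_le2); rewrite mulr0 => ff.
apply/funext => x; have := @lp_le_eq0 2 _ x (ltr0n _ 2) ff.
by move/eqP; rewrite subr_eq0 => /eqP.
Qed.

End Resolvent.
End SymmetricGenerator.

(** * The form of the graph *)

Section GraphForm.
Context (b : X -> X -> R) (c : X -> R) (graph_bc : is_graph b c).

Lemma conj_Qform f g : (Qform b c f g)^* =
  2^-1 * csum (fun xy : X * X => (b xy.1 xy.2)%:C *
           ((f xy.1 - f xy.2)^* * (g xy.1 - g xy.2))) +
  csum (fun x => (c x)%:C * ((f x)^* * g x)).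
Proof.
have half : conjc (2^-1 : R[i]) = 2^-1 by rewrite conjc_inv conjc_nat.
rewrite /Qform conjcD conjcM half -!csum_conj.
congr (_ * _ + _); congr csum; apply/funext; [case=> x y|move=> x] => /=.
  by rewrite 2!conjcM conjc_real !conjCE conjcK.
by rewrite 2!conjcM conjc_real !conjCE conjcK.
Qed.

Lemma Qform_hermitian f g : Qform b c f g = (Qform b c g f)^*.
Proof.
rewrite conj_Qform; congr (_ * _ + _); congr csum; apply/funext; [case=> x y|move=> x] => /=.
  by rewrite [X in _ * X]mulrC.
by rewrite [X in _ * X]mulrC.
Qed.

Lemma Qform_conj f g :
  Qform b c (fun x => (f x)^*) g = (Qform b c f (fun x => (g x)^*))^*.
Proof.
rewrite conj_Qform; congr (_ * _ + _); congr csum; apply/funext => -[x y] /=.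
by rewrite !conjCE !conjcB.
Qed.

Lemma energy_ge0 f : (0 <= energy b c f)%E.
Proof.
apply: adde_ge0; last first.
  apply: esum_ge0 => x _; rewrite lee_fin mulr_ge0 ?sqr_ge0//.
  exact: graph_c_ge0 graph_bc _.
rewrite mule_ge0 ?lee_fin//; apply: esum_ge0 => -[x y] _ /=.
by rewrite lee_fin mulr_ge0 ?sqr_ge0// (graph_b_ge0 graph_bc).
Qed.

Lemma form_domain_lp2 f : form_domain m b c f -> lp m 2%:E f.
Proof.
case=> fQ _; rewrite -[lp _ _ _]/(is_true (lpnorm m 2%:E f < +oo)%E); move: fQ; rewrite /Qnorm.
have := energy_ge0 f; set E := energy _ _ _.
have : (0 <= lpnorm m 2%:E f)%E by exact: poweR_ge0.
case: lpnorm => [n| |]// _ E0 ; first by rewrite ltry.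
have -> : ((+oo : \bar R) `^ 2 = +oo)%E by rewrite /poweR pnatr_eq0.
have -> : (E + +oo = +oo)%E by case: E E0.
by rewrite /poweR invr_eq0 pnatr_eq0.
Qed.

Lemma eq_Qnorm f g : (forall x y, cmod (f x - f y) = cmod (g x - g y)) ->
  (forall x, cmod (f x) = cmod (g x)) -> Qnorm m b c f = Qnorm m b c g.
Proof.
move=> fg2 fg1; rewrite /Qnorm /energy /lpnorm.
have e1 : (fun x => (c x * cmod (f x) ^+ 2)%:E) = fun x => (c x * cmod (g x) ^+ 2)%:E.
  by apply/funext => x; rewrite fg1.
have e2 : (fun x => (cmod (f x) `^ 2 * m x)%:E) = fun x => (cmod (g x) `^ 2 * m x)%:E.
  by apply/funext => x; rewrite fg1.
by rewrite e1 e2; under [in LHS]eq_fun do rewrite fg2.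
Qed.

Lemma form_domain_conj f : form_domain m b c f ->
  form_domain m b c (fun x => (f x)^*).
Proof.
have conjE g : Qnorm m b c (fun x => (g x)^*) = Qnorm m b c g.
  by apply: eq_Qnorm => [x y|x]; rewrite -?conjcB cmod_conj.
case=> fQ fC; split; first by rewrite conjE.
move=> e /fC[phi cphi fphi]; exists (fun x => (phi x)^*).
  by apply: sub_finite_set cphi => x /=; rewrite conjc_eq0.
rewrite -conjE; congr (Qnorm _ _ _ _ < _)%E: fphi.
by apply/funext => x; rewrite !fctE conjcB !conjcK.
Qed.

Lemma form_operator_conj f g : form_operator m b c f g ->
  form_operator m b c (fun x => (f x)^*) (fun x => (g x)^*).
Proof.
case=> fD g2 fg; split; [exact: form_domain_conj|exact: lp_conj|move=> h hD].
rewrite Qform_conj fg; last exact: form_domain_conj.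
rewrite -csum_conj; congr csum; apply/funext => x.
by rewrite 2!conjcM conjc_real !conjCE conjcK.
Qed.

(** The form is evaluated at f and the conjugate of g in both orders, and its hermitian symmetry
    identifies the results; the conjugate of g compensates for the bilinearity of the pairing. *)
Lemma form_operator_sym f f' g g' : form_operator m b c f f' ->
  form_operator m b c g g' -> pairing f' g = pairing f g'.
Proof.
move=> Lf /form_operator_conj Lg; have [fD _ fE] := Lf; have [gD _ gE] := Lg.
have := fE _ gD; rewrite Qform_hermitian (gE _ fD) -csum_conj.
rewrite /pairing => fg; transitivity (csum (fun x => f' x * ((g x)^*)^* * (m x)%:C)).
  by congr csum; apply/funext => x; rewrite !conjCE conjcK.
rewrite -fg; congr csum; apply/funext => x.
by rewrite 2!conjcM conjc_real !conjCE !conjcK [_ * f x]mulrC.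
Qed.

Let edge_sum x := fine (\esum_(y in [set: X]) (b x y)%:E).

Lemma edge_sum_bounded x (A : {fset X}) : \sum_(y <- A) b x y <= edge_sum x.
Proof.
move: A; apply/(esum_le_fset _ (graph_b_ge0 graph_bc x)).
rewrite /edge_sum fineK// ge0_fin_numE ?(graph_b_summable graph_bc)//.
by apply: esum_ge0 => y _; rewrite lee_fin (graph_b_ge0 graph_bc).
Qed.

Lemma edge_sum_ge0 x : 0 <= edge_sum x.
Proof. by have := edge_sum_bounded x fset0; rewrite big_seq_fset0. Qed.

Lemma edge_has_sum x : has_sum (fun y => (b x y)%:C) (edge_sum x)%:C.
Proof. exact: has_sum_nonneg (graph_b_ge0 graph_bc x) (edge_sum_bounded x). Qed.

Lemma edge_weighted_bounded x (h : X -> R[i]) H : 0 <= H ->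
  (forall y, cmod (h y) <= H) ->
  sum_bounded (fun y => (b x y)%:C * h y) (edge_sum x * H).
Proof.
move=> H0 hH A; rewrite (le_trans _ (ler_wpM2r H0 (edge_sum_bounded x A)))//.
rewrite mulr_suml ler_sum// => y _.
by rewrite cmodM cmod_real ger0_norm ?(graph_b_ge0 graph_bc)// ler_wpM2l// (graph_b_ge0 graph_bc).
Qed.

(* Only the edges at x contribute, each counted in both orientations. *)
Lemma edge_form_point x (h : X -> R[i]) H : 0 <= H -> (forall y, cmod (h y) <= H) ->
  let F := fun xy : X * X => (b xy.1 xy.2)%:C *
    ((point x xy.1 - point x xy.2) * (h xy.1 - h xy.2)^*) in
  (exists C, sum_bounded F C) /\
  csum F = 2 * csum (fun y => (b x y)%:C * (h x - h y)^*).
Proof.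
move=> H0 hH F; pose phi y := (b x y)%:C * (h x - h y)^*.
have phiC : sum_bounded phi (edge_sum x * (H + H)).
  apply: edge_weighted_bounded; first exact: addr_ge0.
  by move=> y; rewrite conjCE cmod_conj (le_trans (le_cmodB _ _))// lerD.
(* [F1] collects the pairs starting at x and [F2] those ending there. The pair (x, x) belongs to
   both, harmlessly, since [b x x = 0]. *)
pose F1 (xy : X * X) := if xy.1 == x then phi xy.2 else 0.
pose F2 (xy : X * X) := if xy.2 == x then phi xy.1 else 0.
have FE : F = fun xy => 1 * F1 xy + F2 xy.
  apply/funext => -[u v]; rewrite /F /F1 /F2 /phi /= !pointE mul1r.
  have [->|ux] := eqVneq u x; have [->|vx] := eqVneq v x.
  - by rewrite (graph_b_diag graph_bc) !mul0r addr0.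
  - by rewrite subr0 mul1r addr0.
  - by rewrite (graph_b_sym graph_bc) sub0r add0r mulN1r -rmorphN opprB.
  - by rewrite subrr mul0r mulr0 addr0.
have i1 : injective (fun y : X => (x, y)) by move=> y y' [].
have i2 : injective (fun y : X => (y, x)) by move=> y y' [].
have r1 xy : ~ range (fun y : X => (x, y)) xy -> F1 xy = 0.
  case: xy => u v; rewrite /F1 /=; case: eqP => [->|//] /(_ _)[].
  by exists v.
have r2 xy : ~ range (fun y : X => (y, x)) xy -> F2 xy = 0.
  case: xy => u v; rewrite /F2 /=; case: eqP => [->|//] /(_ _)[].
  by exists u.
have F1E : F1 \o (fun y : X => (x, y)) = phi by apply/funext => y; rewrite /F1 /= eqxx.
have F2E : F2 \o (fun y : X => (y, x)) = phi by apply/funext => y; rewrite /F2 /= eqxx.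
have b1 : sum_bounded F1 (edge_sum x * (H + H)) by apply: sum_bounded_inj i1 r1 _; rewrite F1E.
have b2 : sum_bounded F2 (edge_sum x * (H + H)) by apply: sum_bounded_inj i2 r2 _; rewrite F2E.
split.
  by rewrite FE; eexists; exact: sum_bounded_linear b1 b2.
have hs := csum_has_sum phiC.
rewrite FE (csum_linear 1 b1 b2) mul1r mulr2n mulrDl mul1r; congr (_ + _).
  by apply: csum_eq b1 _; apply: has_sum_inj i1 r1 _; rewrite F1E.
by apply: csum_eq b2 _; apply: has_sum_inj i2 r2 _; rewrite F2E.
Qed.

Lemma Qnorm_lty f C D : lp m 2%:E f ->
  (forall B : {fset X * X},
    \sum_(xy <- B) b xy.1 xy.2 * cmod (f xy.1 - f xy.2) ^+ 2 <= C) ->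
  (forall B : {fset X}, \sum_(x <- B) c x * cmod (f x) ^+ 2 <= D) ->
  (Qnorm m b c f < +oo)%E.
Proof.
move=> f2 fC fD.
have w1 (xy : X * X) : 0 <= b xy.1 xy.2 * cmod (f xy.1 - f xy.2) ^+ 2.
  by rewrite mulr_ge0 ?sqr_ge0// (graph_b_ge0 graph_bc).
have w2 x : 0 <= c x * cmod (f x) ^+ 2.
  by rewrite mulr_ge0 ?sqr_ge0// (graph_c_ge0 graph_bc).
have e1 := (esum_le_fset _ w1).2 fC; have e2 := (esum_le_fset _ w2).2 fD.
have Efin : energy b c f \is a fin_num.
  rewrite ge0_fin_numE ?energy_ge0// (@le_lt_trans _ _ ((2^-1)%:E * C%:E + D%:E)%E)//.
    by rewrite leeD// lee_pmul2l// lte_fin invr_gt0.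
  by rewrite -EFinM -EFinD ltry.
have Nfin : lpnorm m 2%:E f \is a fin_num.
  by rewrite ge0_fin_numE// poweR_ge0.
rewrite /Qnorm; case: (energy b c f) Efin => // E _.
case: (lpnorm m 2%:E f) Nfin => // N _.
by rewrite poweR_EFin -EFinD poweR_EFin ltry.
Qed.

Lemma Qnorm0 : Qnorm m b c (fun=> 0) = 0%E.
Proof.
have half : (2^-1 : R) != 0 by rewrite invr_eq0.
rewrite /Qnorm /energy /lpnorm !esum1 ?mule0 ?adde0 ?poweR_EFin ?powR0 ?addr0 ?powR0// => x _.
- by rewrite cmod0 powR0 ?mul0r.
- by rewrite cmod0 expr0n mulr0.
- by rewrite subrr cmod0 expr0n mulr0.
Qed.

Lemma point_form_domain x : form_domain m b c (point x).
Proof.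
(* With h the point mass itself, the moduli of the edge terms are the energy terms, so their
   summability gives finite energy. *)
have p1 := cmod_point_le1 x; have [[C FC] _] := edge_form_point x ler01 p1.
have b0 u v : 0 <= b u v := graph_b_ge0 graph_bc u v.
have c0 u : 0 <= c u := graph_c_ge0 graph_bc u.
split.
  apply: (@Qnorm_lty _ C (cmod (c x)%:C)).
  - by apply: Cc_lp; [rewrite lee_fin ler1n|exact: Cc_fsupp].
  - move=> B; rewrite (le_trans _ (FC B))// ler_sum// => -[u v] _ /=.
    by rewrite conjCE !cmodM cmod_conj cmod_real (ger0_norm (b0 _ _)) expr2.
  - move=> B; have := @sum_bounded_fset R X [fset x]%fset (fun y => (c y)%:C * point x y).
    rewrite big_seq_fset1 pointE eqxx mulr1 => bnd.
    rewrite (le_trans _ (bnd _ B))//; last by move=> y /point_out ->; rewrite mulr0.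
    apply: ler_sum => y _; rewrite cmodM cmod_real ger0_norm// ler_wpM2l//.
    by rewrite expr2 ler_piMl ?cmod_ge0.
move=> e e0; exists (point x); first exact: Cc_fsupp.
by rewrite subrr -[0]/(fun=> 0) Qnorm0 lte_fin.
Qed.

Section PointOperator.
Context (m0 : R) (m0_gt0 : 0 < m0) (m0_le1 : m0 <= 1) (le_m0 : forall x, m0 <= m x).

(** The witness is the formal Laplacian of the point mass. It is in l^1 because the row b(x, .) is
    summable, hence in l^2 because [m] is bounded below; this stands in for local finiteness. *)
Lemma point_form_operator x : exists g, form_operator m b c (point x) g.
Proof.
pose K := (edge_sum x + c x)%:C : R[i].
pose d y : R[i] := K * point x y + - (b x y)%:C.
have mE y : (m y)%:C != 0 :> R[i] by rewrite (inj_eq (@complexI _)) gt_eqF.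
have b_bounded : sum_bounded (fun y => (b x y)%:C) (edge_sum x).
  move=> A; under eq_bigr do rewrite cmod_real ger0_norm ?(graph_b_ge0 graph_bc)//.
  exact: edge_sum_bounded.
have d_bounded : sum_bounded d (cmod K * cmod 1 + edge_sum x).
  apply: sum_bounded_linear => [A|A].
    have := @sum_bounded_fset R X [fset x]%fset (point x).
    by rewrite big_seq_fset1 pointE eqxx; apply; exact: point_out.
  by under eq_bigr do rewrite cmodN; exact: b_bounded.
exists (fun y => d y / (m y)%:C); split; first exact: point_form_domain.
  apply: (@lp_subset m0 m0_gt0 m0_le1 le_m0 1%:E) => //; rewrite ?lee_fin ?ler1n//.
  apply: (@lp_le_lp _ _ (cmod K * cmod 1 + edge_sum x)); apply/lp_le_finP => //.
  have S0 : 0 <= cmod K * cmod (1 : R[i]) + edge_sum x.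
    by rewrite addr_ge0 ?edge_sum_ge0// mulr_ge0// cmod_ge0.
  split=> // A; rewrite powRr1// (le_trans _ (d_bounded A))// ler_sum// => y _.
  rewrite powRr1 ?cmod_ge0// -[X in _ * X <= _](ger0_norm (m_ge0 y)).
  by rewrite -cmod_real -cmodM divfK.
move=> h hD; have [C hC] := lpP (form_domain_lp2 hD).
(* Functions in l^2 are bounded because [m] is bounded below, so [edge_form_point] applies to every
   h in the form domain. *)
have hb y : cmod (h y) <= C / m0.
  by apply: lp_le_pointwise hC => //; rewrite lee_fin ler1n.
have H0 : 0 <= C / m0 by rewrite divr_ge0 ?(lp_le_ge0 hC)// ltW.
have [_ F2] := edge_form_point x H0 hb.
have cb : sum_bounded (fun y => (b x y)%:C * (h y)^*) (edge_sum x * (C / m0)).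
  by apply: edge_weighted_bounded => // y; rewrite cmod_conj.
have bE : csum (fun y => (b x y)%:C) = (edge_sum x)%:C.
  exact: csum_eq b_bounded (edge_has_sum x).
have hx_bounded : sum_bounded (fun y => (b x y)%:C * (h x)^*) (edge_sum x * (C / m0)).
  by apply: (@edge_weighted_bounded x (fun=> (h x)^*)) => // y; rewrite cmod_conj.
have lhs1 : csum (fun y => (b x y)%:C * (h x - h y)^*) =
    (h x)^* * (edge_sum x)%:C - csum (fun y => (b x y)%:C * (h y)^*).
  rewrite -bE -(csumZ _ b_bounded).
  have -> : (fun y => (h x)^* * (b x y)%:C) = fun y => (b x y)%:C * (h x)^*.
    by apply/funext => y; rewrite mulrC.
  rewrite -(csumB hx_bounded cb); congr csum; apply/funext => y.
  by rewrite !conjCE conjcB mulrBr.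
have lhs2 : csum (fun y => (c y)%:C * (point x y * (h y)^*)) = (c x)%:C * (h x)^*.
  rewrite (@csum_fset _ _ [fset x]%fset) => [|y /point_out ->]; last by rewrite mul0r mulr0.
  by rewrite big_seq_fset1 pointE eqxx mul1r.
have rhs1 : csum (fun y => K * (point x y * (h y)^*)) = K * (h x)^*.
  rewrite (@csum_fset _ _ [fset x]%fset) => [|y /point_out ->]; last by rewrite mul0r mulr0.
  by rewrite big_seq_fset1 pointE eqxx mul1r.
have pb : sum_bounded (fun y => K * (point x y * (h y)^*))
    (\sum_(y <- [fset x]%fset) cmod (K * (point x y * (h y)^*))).
  by apply: sum_bounded_fset => y /point_out ->; rewrite mul0r mulr0.
rewrite /Qform F2 lhs1 lhs2 mulKf ?pnatr_eq0//.
have -> : (fun y => d y / (m y)%:C * (h y)^* * (m y)%:C) =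
    fun y => K * (point x y * (h y)^*) - (b x y)%:C * (h y)^*.
  apply/funext => y; rewrite mulrAC divfK// /d; ring.
by rewrite (csumB pb cb) rhs1 /K rmorphD /=; ring.
Qed.

End PointOperator.
End GraphForm.

Lemma Cc_domain (A : (X -> R[i]) -> (X -> R[i]) -> Prop) :
  (forall (a : R[i]) f f' g g', A f f' -> A g g' ->
     A (fun x => a * f x + g x) (fun x => a * f' x + g' x)) ->
  A (fun=> 0) (fun=> 0) -> (forall x, exists g, A (point x) g) ->
  forall f, Cc f -> exists f', A f f'.
Proof.
move=> Alin A0 /choice[g Ag] f /CcP[B fB].
rewrite (point_sum fB); elim: (enum_fset B) => [|y s [f' Af']].
  by exists (fun=> 0); under [X in A X]eq_fun do rewrite big_nil.
exists (fun x => f y * g y x + f' x).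
by under [X in A X]eq_fun do rewrite big_cons; exact: Alin.
Qed.

Lemma generator0 r T : (1 <= r%:E)%E -> lp_contraction_semigroup m r%:E T ->
  generator m r%:E T (fun=> 0) (fun=> 0).
Proof.
move=> r1 Tr; have z0 := lp_le0 r1; have z2 := lp_le_lp z0.
apply/generatorP; split=> // e e0; exists 1 => // t t0 _.
apply: lp_le_mono (ltW e0); apply: eq_lp_le z0 => x.
have := semigroup_sub Tr (ltW t0) z2 z2.
under [X in T t X]eq_fun do rewrite subrr.
by move=> T0; rewrite /quotient_error T0 subrr !subr0 mulr0.
Qed.

(** * Comparison of the generators for different exponents *)

Section Inclusions.
Context (m0 : R) (m0_gt0 : 0 < m0) (m0_le1 : m0 <= 1) (le_m0 : forall x, m0 <= m x).

(** The same maps T_t act on all the spaces, so convergence of the difference quotients in l^r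
    passes to l^s by the embedding; the tolerance e * m0 offsets its constant. *)
Lemma generator_subset r s T f g : (1 <= r%:E)%E -> r <= s ->
  generator m r%:E T f g -> generator m s%:E T f g.
Proof.
move=> r1 rs /generatorP[fr gr fg].
have emb := lp_embedding m0_gt0 m0_le1 le_m0 r1 (q := s%:E) rs.
have emb' := lp_subset m0_gt0 m0_le1 le_m0 r1 (q := s%:E) rs.
apply/generatorP; split; [exact: emb'|exact: emb'|move=> e e0].
have [d d0 fd] := fg _ (mulr_gt0 e0 m0_gt0); exists d => // t t0 td.
by rewrite -[e](mulfK (lt0r_neq0 m0_gt0)); apply: emb; exact: fd.
Qed.

End Inclusions.

(** The constant in [resolvent_set] may be negative, and the sup norm is -oo when [X] is empty. The
    absolute value and a separate treatment of the empty case yield a bound of the form [lp_le]. *)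
Lemma resolvent_lp_le p f g K C : (1 <= p)%E ->
  (lpnorm m p f <= K%:E * lpnorm m p g)%E -> lp_le p g C -> lp_le p f (`|K| * C).
Proof.
move=> p1 fg gC; have [C0 gC'] := gC.
have KC : 0 <= `|K| * C by rewrite mulr_ge0.
have [N0|N0] := leP 0%E (lpnorm m p g).
  split=> //; rewrite (le_trans fg)// (le_trans (lee_wpmul2r N0 _ (y := `|K|%:E)))//.
    by rewrite lee_fin ler_norm.
  by rewrite EFinM lee_wpmul2l// lee_fin.
case: p p1 fg gC gC' N0 => [r| |]//.
  by move=> _ _ _ _; rewrite ltNge poweR_ge0.
move=> _ _ _ _ N0; apply/lp_le_ooP; split=> // x; exfalso.
move: N0; apply/negP; rewrite -leNgt (@le_trans _ _ (cmod (g x))%:E)//.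
  by rewrite lee_fin cmod_ge0.
by apply: ereal_sup_ubound; exists x.
Qed.

End LebesgueNorms.

Theorem theorem2p2 (R : realType) (X : countType) (m : X -> R)
    (b : X -> X -> R) (c : X -> R)
    (T : R -> (X -> R[i]) -> (X -> R[i]))
    (m_gt0 : forall x, 0 < m x)
    (graph_bc : is_graph b c)
    (T_heat : heat_semigroup m b c T)
    (inf_m_gt0 : (0 < ereal_inf (range (fun x => (m x)%:E)))%E)
    (p : \bar R) (p_ge1 : (1 <= p)%E) :
  spectrum m 2%:E (form_operator m b c) `<=` spectrum m p (Lp m T p).
Proof.
have [m0 [m0_gt0 m0_le1 le_m0]] : exists m0 : R,
    [/\ 0 < m0, m0 <= 1 & forall x, m0 <= m x].
  have inf_le x : (ereal_inf (range (fun x => (m x)%:E)) <= (m x)%:E)%E.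
    by apply: ereal_inf_lbound; exists x.
  (* The minimum with 1 normalises the lower bound for the embeddings. An infinite infimum means
     that [X] is empty, and then 1 serves. *)
  move: inf_m_gt0 inf_le; case: ereal_inf => [r| |]// r0 rm.
    exists (Num.min r 1); split; first by rewrite lt_min ltr01 andbT -lte_fin.
      by rewrite ge_min lexx orbT.
    by move=> x; rewrite ge_min -lee_fin rm.
  exists 1; split=> // x; have := rm x; by rewrite leye_eq.
have T2 := heat_contraction T_heat (p := 2%:E) (lee_tofin (ler1n R 2)).
have T2_cont := heat_continuous T_heat (p := 2%:E) (lee_tofin (ler1n R 2)) (ltry 2).
have LE : form_operator m b c = generator m 2%:E T.
  by apply/funext => f; apply/funext => g; apply/propext;
    split=> /(heat_generator T_heat).
have one_le2 : (1%:E <= 2%:E :> \bar R)%E by rewrite lee_fin ler1n.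
have L_sym f f' g g' : generator m 2%:E T f f' -> generator m 2%:E T g g' ->
    pairing m f' g = pairing m f g'.
  by rewrite -LE; exact: form_operator_sym.
have L_conj f g : generator m 2%:E T f g ->
    generator m 2%:E T (fun x => (f x)^*) (fun x => (g x)^*).
  by rewrite -LE; exact: form_operator_conj.
have L_lin : forall (a : R[i]) f f' g g', generator m 2%:E T f f' ->
    generator m 2%:E T g g' -> generator m 2%:E T
      (fun x => a * f x + g x) (fun x => a * f' x + g' x).
  by move=> *; exact: generator_linear.
have L_Cc : forall f, Cc f -> exists f', generator m 2%:E T f f'.
  apply: (Cc_domain L_lin); first exact: generator0.
  by move=> x; rewrite -LE; exact: (point_form_operator m_gt0 graph_bc m0_gt0 m0_le1 le_m0).
move=> z; rewrite LE => zL [K res]; apply: zL.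
have K0 : 0 <= `|K| by [].
(* The bound in [resolvent_set] concerns one solution; uniqueness makes it hold for any solution. *)
have unique_le : forall u g C, Lp m T p u (fun x => g x + z * u x) ->
    lp_le m p g C -> lp_le m p u (`|K| * C).
  move=> u g C Au gC; have [f [_ fK funiq]] := res _ (lp_le_lp gC).
  by rewrite (funiq _ Au); exact: resolvent_lp_le fK gC.
have [p_le2|p_gt2] := leP p 2%:E.
  case: p p_ge1 p_le2 res unique_le => [r| |]// r1 r2 res unique_le.
  apply: (resolvent_criterion m_gt0 T2 T2_cont L_sym L_Cc m0_gt0 m0_le1 le_m0
    L_conj r1 r2 K0) => v vr.
  have [f [Af _ _]] := res v vr; exists f.
    exact: (generator_subset m_gt0 m0_gt0 m0_le1 le_m0 r1 _ Af).
  by move=> D; exact: unique_le Af.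
have p_ge2 := ltW p_gt2.
have [s [pq s1 s2]] := dual_exponents_ge2 p_ge2.
have Aex g : Cc g -> exists u, Lp m T p u (fun x => g x + z * u x).
  by move=> /(Cc_lp m_gt0 p_ge1)/res[f [Af _ _]]; exists f.
have [Alin LA] : (forall (a : R[i]) f f' g g', Lp m T p f f' -> Lp m T p g g' ->
      Lp m T p (fun x => a * f x + g x) (fun x => a * f' x + g' x)) /\
    (forall f g, generator m 2%:E T f g -> Lp m T p f g).
  case: p p_ge1 p_ge2 pq {res unique_le p_gt2 Aex} => [r| |]// r1 r2 pq.
    split=> [a f f' g g'|f g].
      by apply: generator_linear => //; exact: (heat_contraction T_heat).
    exact: (generator_subset m_gt0 m0_gt0 m0_le1 le_m0 one_le2).
  have poo : forall v f, lp m 1%:E v -> lp m +oo%E f -> paired m f v.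
    by move=> v f v1 foo; exact: (paired_lp m_gt0 DualOo foo v1).
  split=> [a f f' g g' [foo f'oo ff'] [goo g'oo gg']|f g Lfg].
    split; [exact: lp_linear|exact: lp_linear|move=> u v Auv].
    have [u1 v1 _] := Auv.
    have := pairing_linear a (poo _ _ v1 foo) (poo _ _ v1 goo).
    have := pairing_linear a (poo _ _ u1 f'oo) (poo _ _ u1 g'oo).
    rewrite (pairingC m f v) (pairingC m g v) (pairingC m f' u) (pairingC m g' u).
    have ff : pairing m v f = pairing m u f' := ff' _ _ Auv.
    have gg : pairing m v g = pairing m u g' := gg' _ _ Auv.
    rewrite ff gg => <-; rewrite pairingC [RHS]pairingC; exact.
  have [f2 g2 _] := Lfg.
  split; [exact: (lp_subset m_gt0 m0_gt0 m0_le1 le_m0 one_le2 (leey _) f2)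
         |exact: (lp_subset m_gt0 m0_gt0 m0_le1 le_m0 one_le2 (leey _) g2)|].
  (* L_1 is itself a restriction of L, so the identity defining its dual follows from symmetry of
     L. *)
  move=> u v Auv; apply: L_sym Lfg.
  by apply: (generator_subset m_gt0 m0_gt0 m0_le1 le_m0 _ _ Auv) => //; exact: ler1n.
apply: (resolvent_criterion m_gt0 T2 T2_cont L_sym L_Cc m0_gt0 m0_le1 le_m0
  L_conj (q := s%:E) _ _ K0) => //.
exact: (transpose_resolvent m_gt0 T2 T2_cont L_sym L_Cc m0_gt0 m0_le1 le_m0
  pq p_ge2 _ K0 Alin LA Aex unique_le).
Qed.
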